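(* Let $\alpha$ be the unique root in $(0,\tfrac12)$ of $x^3-x^2-2x+1$, put $\beta=\alpha^2$ and $q_0=(1-\alpha)^2$, and let $S:[0,1)\to[0,1)$ be the map $$S(x)=\begin{cases}x+\alpha,&x\in I_1=[0,1-\alpha),\\ x+\beta,&x\in I_2=[1-\alpha,1-\beta),\\ x+\beta-1,&x\in I_3=[1-\beta,1),\end{cases}$$ with its unique invariant Borel probability measure $\mu$. For $r\ge0$ put $$u_r=\alpha(1-q_0^{\,r+1}),\qquad v_r=2\alpha-\beta-(\alpha-\beta)q_0^{\,r+1}.$$ Then the canonical defect cut set of $(S,\mu)$ is $$\mathcal C_{\mathrm{def}}=\{0,1,\alpha,2\alpha-\beta\}\cup\{u_r:r\ge0\}\cup\{v_r:r\ge0\}.$$ In particular, $\mathcal C_{\mathrm{def}}$ is closed, countably infinite and Lebesgue-null. Its only accumulation points are $\alpha$ and $2\alpha-\beta$. Consequently, the ordinary distribution-coordinate model $T$ is a countable interval exchange transformation.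
   Context: The map $S$ has exactly one invariant Borel probability measure $\mu$ (invariance: $\mu(S^{-1}B)=\mu(B)$ for Borel $B$), and $\mu$ is non-atomic. It is also regarded as a measure on $[0,1]$ with $\mu(\{1\})=0$; $J=\operatorname{supp}\mu\subset[0,1]$; $h(x)=\mu([0,x])$ for $x\in[0,1]$. Write $t_0=0$, $t_1=1-\alpha$, $t_2=1-\beta$, $t_3=1$, $c_1=\alpha$, $c_2=\beta$, $c_3=\beta-1$ and $\tau_k(x)=x+c_k$ for $x\in I_k$. Canonical defect cut set. For Borel $B\subset I_k$ put $\sigma_k(B)=\mu(\tau_k(B))-\mu(B)$; this is a finite positive Borel measure on $I_k$. For Borel $E\subset[0,1]$ put $\rho_k(E)=\sigma_k(h^{-1}(E)\cap I_k)$. Then $\mathcal C_{\mathrm{def}}=\{h(t_0),h(t_1),h(t_2),h(t_3)\}\cup\bigcup_{k=1}^3\operatorname{supp}\rho_k$. Distribution-coordinate model $T$. Fix a Borel set $X_0\subset J$ with $\mu(X_0)=1$, $S(X_0)=X_0$, such that $S:X_0\to X_0$ is a measurable bijection with measurable, measure-preserving inverse (such a set exists). Let $E_0$ be the countable set consisting of $t_0,\dots,t_3$ and all endpoints of connected components of $[0,1]\setminus J$, and $X=X_0\setminus\bigcup_{m\in\mathbb Z}S^m(E_0\cap X_0)$, where $S^m$ refers to the bijection $S:X_0\to X_0$. Then $h$ is injective on $X$, $Y=h(X)$ has full Lebesgue measure; with $q:Y\to X$ the inverse of $h:X\to Y$, put $T(u)=h(S(q(u)))$ for $u\in Y$ and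 $T(u)=u_*$, a fixed point of $[0,1]$, otherwise. A measurable map $R:[0,1]\to[0,1]$ is a countable interval exchange transformation (modulo Lebesgue-null sets) if there is a countable family of pairwise disjoint open intervals $U_m$ whose union has full Lebesgue measure, and constants $d_m$, such that $R(u)=u+d_m$ for a.e. $u\in U_m$, while the intervals $U_m+d_m$ are contained in $[0,1]$ up to endpoints, are pairwise disjoint modulo endpoints, and cover $[0,1]$ modulo a null set. *)

(* Defs.v *)
From HB Require Import structures.
From mathcomp Require Import all_boot all_order all_algebra.
From mathcomp Require Import all_classical all_reals all_analysis.
Import Order.TTheory GRing.Theory Num.Theory.
Import numFieldNormedType.Exports.

Set Implicit Arguments.
Unset Strict Implicit.
Unset Printing Implicit Defensive.

Local Open Scope classical_set_scope.
Local Open Scope ring_scope.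

Notation borel R := (measurableTypeR R).

(* Only the values on [0, 1[ are meaningful. *)
Definition itm {R : realType} (alpha beta : R) (x : R) : R :=
  if x < 1 - alpha then x + alpha
  else if x < 1 - beta then x + beta
  else x + beta - 1.

(* The pieces are indexed by k = 0, 1, 2, so that `piece alpha beta k` is
   I_(k+1), on which the translation constant is (shifts alpha beta)`_k. *)
Definition cuts {R : realType} (alpha beta : R) : seq R :=
  [:: 0; 1 - alpha; 1 - beta; 1].

Definition shifts {R : realType} (alpha beta : R) : seq R :=
  [:: alpha; beta; beta - 1].

Definition piece {R : realType} (alpha beta : R) (k : nat) : set R :=
  `[(cuts alpha beta)`_k, (cuts alpha beta)`_k.+1[%classic.

(* Borel probability measures on [0, 1[ are represented as probabilities on R
   giving full mass to [0, 1[. *)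
Definition invariant {R : realType} (alpha beta : R)
    (mu : probability (borel R) R) : Prop :=
  mu `[0, 1[%classic = 1%E /\
  forall B : set (borel R), measurable B ->
    mu (`[0, 1[%classic `&` itm alpha beta @^-1` B) = mu B.

Definition uniquely_invariant {R : realType} (alpha beta : R)
    (mu : probability (borel R) R) : Prop :=
  invariant alpha beta mu /\
  forall nu : probability (borel R) R, invariant alpha beta nu ->
    forall B : set (borel R), measurable B -> nu B = mu B.

Definition nonatomic {R : realType} (mu : probability (borel R) R) : Prop :=
  forall A : set (borel R), measurable A -> (0 < mu A)%E ->
    exists B : set (borel R),
      [/\ measurable B, B `<=` A, (0 < mu B)%E & (mu B < mu A)%E].

Definition measure_support {R : realType} (nu : set R -> \bar R) : set R :=
  [set x | forall U : set R, open U -> U x -> (0 < nu U)%E].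

Definition distr_fun {R : realType} (mu : probability (borel R) R) (x : R) : R :=
  fine (mu `[0, x]%classic).

(* sigma_(k+1)(B) = mu(tau_(k+1)(B)) - mu(B), for B included in the k-th piece *)
Definition defect {R : realType} (alpha beta : R)
    (mu : probability (borel R) R) (k : nat) (B : set R) : \bar R :=
  (mu ((fun x : R => (x + (shifts alpha beta)`_k)%R) @` B) - mu B)%E.

(* rho_(k+1)(E) = sigma_(k+1)(h^-1(E) :&: I_(k+1)), with h = distr_fun mu *)
Definition distr_defect {R : realType} (alpha beta : R)
    (mu : probability (borel R) R) (k : nat) (E : set R) : \bar R :=
  defect alpha beta mu k (distr_fun mu @^-1` E `&` piece alpha beta k).

Definition defect_cut_set {R : realType} (alpha beta : R)
    (mu : probability (borel R) R) : set R :=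
  distr_fun mu @` [set` cuts alpha beta] `|`
  \bigcup_(k < 3) measure_support (distr_defect alpha beta mu k).

(* For a bijection f of X0 onto itself, the m-th iterate of f on X0. *)
Definition bij_iter {R : realType} (X0 : set R) (f : R -> R) (m : int) : R -> R :=
  match m with
  | Posz n => iter n f
  | Negz n => iter n.+1 (pinv X0 f)
  end.

Definition bijective_core {R : realType} (alpha beta : R)
    (mu : probability (borel R) R) (X0 : set R) : Prop :=
  let S := itm alpha beta in
  let Sinv := pinv X0 S in
  [/\ measurable (X0 : set (borel R)),
      X0 `<=` measure_support mu `&` `[0, 1[%classic &
      mu X0 = 1%E] /\
  [/\ set_bij X0 X0 S,
      measurable_fun (X0 : set (borel R)) (S : borel R -> borel R),
      measurable_fun (X0 : set (borel R)) (Sinv : borel R -> borel R) &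
      forall B : set (borel R), measurable B ->
        mu (X0 `&` Sinv @^-1` B) = mu (X0 `&` B)].

(* The components of [0, 1] \ supp mu are bounded intervals, whose endpoints
   are their infimum and supremum. *)
Definition exceptional_points {R : realType} (alpha beta : R)
    (mu : probability (borel R) R) : set R :=
  let G := `[0, 1]%classic `\` measure_support mu in
  [set` cuts alpha beta] `|`
  [set e | exists2 x, G x &
     e = inf (connected_component G x) \/ e = sup (connected_component G x)].

Definition trimmed_core {R : realType} (alpha beta : R)
    (mu : probability (borel R) R) (X0 : set R) : set R :=
  X0 `\` \bigcup_(m : int)
           (bij_iter X0 (itm alpha beta) m @`
              (exceptional_points alpha beta mu `&` X0)).

Definition distr_model {R : realType} (alpha beta : R)
    (mu : probability (borel R) R) (X0 : set R) (ustar : R) (u : R) : R :=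
  let X := trimmed_core alpha beta mu X0 in
  if u \in distr_fun mu @` X
  then distr_fun mu (itm alpha beta (pinv X (distr_fun mu) u))
  else ustar.

(* The intervals U_m = ]a m, b m[ are indexed by a set D of naturals, so that
   finite families are allowed. As the translated intervals are open, inclusion
   up to endpoints and disjointness modulo endpoints are plain inclusion and
   disjointness. *)
Definition countable_iet {R : realType} (f : R -> R) : Prop :=
  let leb := @lebesgue_measure R in
  [/\ set_fun `[0, 1]%classic `[0, 1]%classic f,
      measurable_fun (`[0, 1]%classic : set (borel R)) (f : borel R -> borel R) &
      exists (D : set nat) (a b d : nat -> R),
        let U m : set R := `]a m, b m[%classic in
        let V m : set R := (fun u => u + d m) @` U m in
        [/\ forall m, D m -> a m < b m /\ U m `<=` `[0, 1]%classic,
            trivIset D U,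
            leb (`[0, 1]%classic `\` \bigcup_(m in D) U m) = 0%E &
            forall m, D m -> {ae leb, forall u, U m u -> f u = u + d m}] /\
        [/\ forall m, D m -> V m `<=` `[0, 1]%classic,
            trivIset D V &
            leb (`[0, 1]%classic `\` \bigcup_(m in D) V m) = 0%E]].

Definition cut_u {R : realType} (alpha q0 : R) (r : nat) : R :=
  alpha * (1 - q0 ^+ r.+1).

Definition cut_v {R : realType} (alpha beta q0 : R) (r : nat) : R :=
  2 * alpha - beta - (alpha - beta) * q0 ^+ r.+1.

(* Main.v *)
Require Import Defs.
From HB Require Import structures.
From mathcomp Require Import all_boot all_order all_algebra.
From mathcomp Require Import all_classical all_reals all_analysis.
From mathcomp Require Import measurable_realfun ring lra.
Import Order.TTheory GRing.Theory Num.Theory.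
Import numFieldNormedType.Exports.

(* Write I1, I2, I3 for the three pieces of S, phi y = 1 - alpha + alpha y and
   h x = mu([0, x]).  The cubic equation makes the first-return map of S to
   [1 - alpha, 1) equal to phi S phi^-1, so unique invariance forces mu restricted
   to [1 - alpha, 1) to be a scaled copy of mu; the scaling factor solves a cubic
   and equals 1 - alpha.  The interval [beta, alpha) is missed by S, and mu on
   [alpha, 1 - alpha) is the copy of mu on I1 under theta y = alpha + beta y, with
   mass factor q0 = (1 - alpha)^2.

   The images of I1 and I2 overlap: S (phi y) = S (psi y) for y in I1, with
   psi y = q0 + alpha y, and this overlap carries the defect.  Now psi sends
   [0, beta) into the gap [beta, alpha], where h = q0, and psi theta = theta psi,
   while h (theta y) = q0 + q0 (h y).  Hence under mu the function h (psi y), y in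
   I1, only takes the values w_0 = q0 and w_(r+1) = q0 + q0 w_r, that is u_r, with
   positive mass.  So rho_1 is purely atomic on the u_r, rho_2 on their images v_r
   under w |-> alpha + (1 - alpha) w, and rho_3 = 0.  Between two consecutive cuts
   the defect does not charge, so h (S x) - h x is constant there. *)

Local Open Scope classical_set_scope.
Local Open Scope ring_scope.

Set Implicit Arguments.
Unset Strict Implicit.
Unset Printing Implicit Defensive.

(** * Auxiliary facts on countable sets, translations and increasing sequences *)

Lemma countable_setU T (A B : set T) : countable A -> countable B ->
  countable (A `|` B).
Proof.
move=> cA cB; have -> : A `|` B = \bigcup_(b in [set: bool]) (if b then A else B).
  apply/seteqP; split=> x.
    by case; [exists true|exists false].
  by move=> [[] _ ?]; [left|right].
by apply: bigcup_countable => // -[].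
Qed.

Lemma countable_range_nat T (f : nat -> T) : countable (range f).
Proof. by apply: sub_countable (card_image_le _ _) _. Qed.

Section generalities.
Context {R : realType}.

Lemma exists_natSinv_lt (d : R) : 0 < d -> exists n : nat, n.+1%:R^-1 < d.
Proof.
move=> d0; have [n _ /(_ n (leqnn n)) nd] := near_infty_natSinv_lt (PosNum d0).
by exists n.
Qed.

Lemma translate_preimage (c : R) (B : set R) :
  (fun x => x + c) @` B = [set z | B (z - c)].
Proof.
apply/seteqP; split=> z /=; first by move=> [x Bx <-]; rewrite addrK.
by move=> Bz; exists (z - c) => //; rewrite subrK.
Qed.

Lemma bracket (c : nat -> R) t : c 0 <= t -> (exists n, t < c n) ->
  exists n, c n <= t < c n.+1.
Proof.
move=> c0 ex; case: (ex_minnP ex) => -[|n] tn nmin; first by move: tn; lra.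
exists n; rewrite tn andbT leNgt; apply/negP => /nmin.
by rewrite ltnn.
Qed.

Lemma increasing_bracket_inj (c : nat -> R) m n z : (forall k, c k < c k.+1) ->
  c m < z < c m.+1 -> c n < z < c n.+1 -> m = n.
Proof.
move=> /increasing_seqP ci /andP[mz zm] /andP[nz zn].
have := lt_trans mz zn; have := lt_trans nz zm.
rewrite !ltNge !ci -!ltnNge !ltnS => nm mn.
by apply/eqP; rewrite eqn_leq mn nm.
Qed.

Lemma mnormalizeE d (T : measurableType d) (nu : {measure set T -> \bar R})
    (P : probability T R) (A : set T) (c : R) :
  nu setT = c%:E -> 0 < c -> mnormalize nu P A = (nu A * (c^-1)%:E)%E.
Proof. by rewrite /mnormalize => -> c0; rewrite eqe gt_eqF. Qed.

End generalities.

Section measurable_predicates.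
Context {R : realType}.
Implicit Types (A B : set (borel R)) (f g : borel R -> borel R).

(** Events are kept as comprehensions of conjunctions, so that [lra] can compare them pointwise.
    Closure under intersection is restated in that shape for [measurable_tac] to apply it
    syntactically. *)
Lemma measurable_and_pred A B : measurable A -> measurable B ->
  measurable ([set x | A x /\ B x] : set (borel R)).
Proof. exact: measurableI. Qed.

Lemma measurable_andb_pred (p q : borel R -> bool) :
  measurable [set x | p x] -> measurable [set x | q x] ->
  measurable [set x | p x && q x].
Proof.
move=> mp mq; rewrite [X in measurable X](_ : _ = [set x | p x] `&` [set x | q x]).
  exact: measurableI.
by apply/seteqP; split=> x /=; [move/andP|move=> /andP].
Qed.

Lemma measurable_comp_pred f B : measurable_fun setT f -> measurable B ->
  measurable ([set x | B (f x)] : set (borel R)).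
Proof. by move=> mf mB; rewrite -[X in measurable X]setTI; exact: mf. Qed.

Lemma measurable_le_pred f g : measurable_fun setT f -> measurable_fun setT g ->
  measurable ([set x | (f x : R) <= g x] : set (borel R)).
Proof.
move=> mf mg; have := measurable_fun_ler mf mg => /(_ measurableT [set true] I).
by rewrite setTI.
Qed.

Lemma measurable_lt_pred f g : measurable_fun setT f -> measurable_fun setT g ->
  measurable ([set x | (f x : R) < g x] : set (borel R)).
Proof.
move=> mf mg; have := measurable_fun_ltr mf mg => /(_ measurableT [set true] I).
by rewrite setTI.
Qed.

Lemma measurable_fun_translate (c : R) :
  measurable_fun [set: borel R] (fun x : borel R => (x : R) + c : borel R).
Proof. by apply: measurable_funD => //; exact: measurable_id. Qed.

Lemma measurable_fun_affine (a c : R) :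
  measurable_fun [set: borel R] (fun x : borel R => c + a * (x : R) : borel R).
Proof.
by apply: measurable_funD => //; apply: measurable_funM => //; exact: measurable_id.
Qed.

End measurable_predicates.

Ltac measurable_fun_tac := repeat first
  [ assumption | exact: measurable_id | exact: measurable_cst
  | apply: measurable_funB | apply: measurable_funD | apply: measurable_funM ].

Ltac measurable_tac := repeat first
  [ assumption
  | apply: measurable_and_pred | apply: measurable_andb_pred
  | apply: measurable_le_pred; solve [measurable_fun_tac]
  | apply: measurable_lt_pred; solve [measurable_fun_tac]
  | apply: measurable_comp_pred; first solve [measurable_fun_tac]
  | exact: measurableT | exact: measurable_set1 | exact: measurable_itv ].

Ltac split_conj := repeat match goal with H : _ /\ _ |- _ => destruct H end;
  repeat match goal with |- _ /\ _ => split end.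

(** * Real-valued masses *)

Section real_mass.
Context {R : realType} (mu : probability (borel R) R).
Implicit Types A B : set (borel R).

Definition real_mass (A : set R) : R := fine (mu A).

Lemma massE A : measurable A -> mu A = (real_mass A)%:E.
Proof. by move=> mA; rewrite /real_mass fineK// fin_num_measure. Qed.

Lemma eq_mass (A B : set R) : (forall x, A x <-> B x) -> real_mass A = real_mass B.
Proof. by move=> AB; congr real_mass; apply/seteqP; split=> x /AB. Qed.

Lemma mass_ge0 A : 0 <= real_mass A.
Proof. by rewrite fine_ge0. Qed.

Lemma mass_set0 : real_mass set0 = 0.
Proof. by rewrite /real_mass measure0. Qed.

Lemma mass_eq0 A : (forall x, ~ A x) -> real_mass A = 0.
Proof.
by move=> A0; rewrite -mass_set0; apply: eq_mass => x; split=> // /A0.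
Qed.

Lemma massT : real_mass setT = 1.
Proof. by rewrite /real_mass probability_setT. Qed.

Lemma massU A B : measurable A -> measurable B -> (forall x, A x -> ~ B x) ->
  real_mass [set x | A x \/ B x] = real_mass A + real_mass B.
Proof.
move=> mA mB AB; apply: EFin_inj; rewrite EFinD -!massE //.
- rewrite -measureU //; apply/seteqP; split=> // x [Ax Bx]; exact: AB Bx.
- exact: measurableU.
Qed.

Lemma le_mass A B : measurable A -> measurable B -> (forall x, A x -> B x) ->
  real_mass A <= real_mass B.
Proof.
move=> mA mB AB; rewrite -lee_fin -!massE//.
by apply: le_measure; rewrite ?inE.
Qed.

Lemma mass_cut A B : measurable A -> measurable B ->
  real_mass A = real_mass [set x | B x /\ A x] + real_mass [set x | ~ B x /\ A x].
Proof.
move=> mA mB; rewrite -massU.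
- by apply: eq_mass => x /=; have [] := pselect (B x); tauto.
- exact: measurable_and_pred.
- by apply: measurable_and_pred => //; exact: measurableC.
- by move=> x /=; tauto.
Qed.

Lemma massI_full A B : measurable A -> measurable B -> real_mass B = 1 ->
  real_mass [set x | B x /\ A x] = real_mass A.
Proof.
move=> mA mB B1; have mC : measurable (~` B) by exact: measurableC.
have mCA := measurable_and_pred mC mA.
have mBC := measurable_and_pred mB mA.
have C0 : real_mass (~` B) = 0.
  rewrite /real_mass probability_setC// massE// B1 subee//.
rewrite (mass_cut mA mB).
have : real_mass [set x | (~` B) x /\ A x] <= 0 by rewrite -C0 le_mass// => x [].
by move=> h; have := mass_ge0 [set x | (~` B) x /\ A x]; rewrite /setC /=; lra.
Qed.

End real_mass.

Ltac mass_ext := apply: eq_mass => ? /=; split=> ?; split_conj => //; lra.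

Ltac mass_empty := move=> ? /= ?; split_conj; lra.

(** * Renormalization *)

Section renormalization.
Context {R : realType} (alpha beta : R).
Hypotheses (alpha_gt0 : 0 < alpha) (alpha_lt : alpha < 1 / 2).
Hypothesis alpha_root : alpha ^+ 3 - alpha ^+ 2 - 2 * alpha + 1 = 0.
Hypothesis betaE : beta = alpha ^+ 2.

Lemma alpha_bounds : 11 / 25 < alpha < 9 / 20.
Proof.
have a0 := alpha_gt0; have a1 := alpha_lt.
have root : alpha * alpha * alpha - alpha * alpha - 2 * alpha + 1 = 0.
  by move: alpha_root; rewrite !exprS expr0; lra.
have a2 : 0 <= alpha * (1 / 2 - alpha) by apply: mulr_ge0; lra.
apply/andP; split; rewrite ltNge; apply/negP => h.
(* The second factor is minus the difference quotient of the cubic between [alpha] and 11/25,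
   positive by [a2]. The product is thus minus the value of the cubic at 11/25; the analogous
   product below is its value at 9/20. Both numbers are negative. *)
- have : 0 <= (11 / 25 - alpha) * (1404 / 625 + 14 / 25 * alpha - alpha * alpha).
    by apply: mulr_ge0; lra.
  by lra.
- have : 0 <= (alpha - 9 / 20) * (899 / 400 + 11 / 20 * alpha - alpha * alpha).
    by apply: mulr_ge0; lra.
  by lra.
Qed.

Lemma beta_bounds : 121 / 625 < beta < 81 / 400.
Proof. by have := alpha_bounds; rewrite betaE => ?; apply/andP; split; nra. Qed.

(** The cubic as a reduction rule: together with [alpha_alpha] it makes the monomials of degree two
    and three linear in [alpha] and [beta], within reach of [lra]. *)
Lemma alpha_beta : alpha * beta = beta + 2 * alpha - 1.
Proof. by have := alpha_root; rewrite betaE !exprS expr0; lra. Qed.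

Lemma alpha_alpha : alpha * alpha = beta.
Proof. by rewrite betaE expr2. Qed.

(** phi carries the cut 1 - alpha to the cut 1 - beta. By [zoom_cut2] it carries 1 - beta to 2 - 2
    alpha - beta, the point of I3 where the return time to [1 - alpha, 1) changes. *)
Lemma zoom_cut1 : 1 - beta = 1 - alpha + alpha * (1 - alpha).
Proof. by have := alpha_alpha; rewrite mulrBr; lra. Qed.

Lemma zoom_cut2 : 2 - 2 * alpha - beta = 1 - alpha + alpha * (1 - beta).
Proof. by have := alpha_beta; rewrite mulrBr; lra. Qed.

Variable mu : probability (borel R) R.
Hypothesis mu_inv : Defs.invariant alpha beta mu.
Local Notation mass := (real_mass mu).
Implicit Types A B : set (borel R).

Lemma mass_unit_itv A : measurable A ->
  mass [set x | 0 <= x < 1 /\ A x] = mass A.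
Proof.
move=> mA; apply: (@massI_full _ mu A [set x : R | 0 <= x < 1]) => //.
  by measurable_tac.
by rewrite /real_mass [X in mu X](_ : _ = `[0, 1[%classic) ?mu_inv.1.
Qed.

(** Invariance, with the preimage of A cut along the three branches. Most computations below apply
    this to events for which some branches contribute nothing. *)
Lemma mass_branches A : measurable A ->
  mass A = mass [set x : R | 0 <= x < 1 - alpha /\ A (x + alpha)]
         + mass [set x : R | 1 - alpha <= x < 1 - beta /\ A (x + beta)]
         + mass [set x : R | 1 - beta <= x < 1 /\ A (x + beta - 1)].
Proof.
move=> mA; have ab := alpha_bounds; have bb := beta_bounds.
rewrite -!massU; last first.
- by move=> x /= [? ?] []; lra.
- by measurable_tac.
- by measurable_tac.
- by move=> x /= [] [? ?] []; lra.
- by measurable_tac.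
- by apply: measurableU; measurable_tac.
rewrite /real_mass -mu_inv.2//; congr (fine (mu _)).
apply/seteqP; split=> x /=; rewrite in_itv /= /itm.
- case: (ltP x (1 - alpha)) => ?; first by move=> [? ?]; left; left; split=> //; lra.
  case: (ltP x (1 - beta)) => ?; first by move=> [? ?]; left; right; split=> //; lra.
  by move=> [? ?]; right; split=> //; lra.
- move=> [[] [h ?]|[h ?]]; (split; first lra).
  + by have -> : x < 1 - alpha by lra.
  + by rewrite ifF ?ifT//; lra.
  + by rewrite ifF ?ifF//; lra.
Qed.

(* The first return to [1 - alpha, 1) takes one step from the second piece, and two
   or three from the third one. *)
Lemma mass_return A : measurable A ->
  mass [set x : R | 1 - alpha <= x < 1 /\ A x]
  = mass [set x : R | 1 - alpha <= x < 1 - beta /\ A (x + beta)]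
  + mass [set x : R | 1 - beta <= x < 1 /\
        (x + beta - 1 + alpha < 1 - alpha /\ A (x + beta - 1 + alpha + alpha))]
  + mass [set x : R | 1 - beta <= x < 1 /\
        (1 - alpha <= x + beta - 1 + alpha /\ A (x + beta - 1 + alpha))].
Proof.
move=> mA; have ab := alpha_bounds; have bb := beta_bounds.
(* [E1] and [E2] consist of the points of I1 that reach the base after exactly one and exactly two
   steps. Pulling [E1] back gives [E2] and part of I3; pulling [E2] back leads to I3 only. *)
pose E1 := [set x : R | 0 <= x < 1 - alpha /\
  (1 - alpha <= x + alpha < 1 /\ A (x + alpha))].
pose E2 := [set x : R | 0 <= x < 1 - 2 * alpha /\
  (1 - 2 * alpha <= x + alpha /\ A (x + alpha + alpha))].
have -> : mass [set x : R | 1 - alpha <= x < 1 /\ A x] =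
    mass E1 + mass [set x : R | 1 - alpha <= x < 1 - beta /\ A (x + beta)].
  rewrite mass_branches; last by measurable_tac.
  rewrite [X in _ + X]mass_eq0 ?addr0; last by mass_empty.
  by congr (_ + _); rewrite /E1; mass_ext.
have -> : mass E1 = mass E2 + mass [set x : R | 1 - beta <= x < 1 /\
        (1 - alpha <= x + beta - 1 + alpha /\ A (x + beta - 1 + alpha))].
  rewrite mass_branches; last by measurable_tac.
  rewrite [X in _ + X + _]mass_eq0 ?addr0; last first.
    by rewrite /E1 => x /= ?; split_conj; lra.
  by congr (_ + _); rewrite /E1 /E2; mass_ext.
have -> : mass E2 = mass [set x : R | 1 - beta <= x < 1 /\
        (x + beta - 1 + alpha < 1 - alpha /\ A (x + beta - 1 + alpha + alpha))].
  rewrite mass_branches; last by measurable_tac.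
  rewrite [X in X + _ + _]mass_eq0 ?add0r; last first.
    by rewrite /E2 => x /= ?; split_conj; lra.
  rewrite [X in X + _]mass_eq0 ?add0r; last first.
    by rewrite /E2 => x /= ?; split_conj; lra.
  by rewrite /E2; mass_ext.
by lra.
Qed.

(** A null base would make I2 and I3 null, so that only the first branch would carry mass, and a
    point cannot stay on that branch for long. Positivity is what allows conditioning on the
    base. *)
Lemma mass_base_gt0 : 0 < mass [set x : R | 1 - alpha <= x < 1].
Proof.
have ab := alpha_bounds; have bb := beta_bounds.
have mI (a b : R) : measurable ([set x : R | a <= x < b] : set (borel R)).
  by measurable_tac.
pose D := [set x : R | 1 - alpha <= x < 1]; rewrite -/D.
rewrite lt_neqAle mass_ge0 andbT eq_sym; apply/eqP => D0.
have sub0 B : measurable B -> (forall x, B x -> D x) -> mass B = 0.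
  move=> mB BD; apply/eqP; rewrite eq_le mass_ge0 andbT -D0.
  exact: (le_mass mu mB (mI _ _)) BD.
have J0 (c : R) : c <= 1 - alpha -> mass [set x : R | 0 <= x < c] =
    mass [set x : R | 0 <= x < c - alpha].
  move=> hc; rewrite mass_branches; last exact: mI.
  rewrite [X in _ + X]sub0; [|by measurable_tac|]; last first.
    by move=> x /= ?; rewrite /D /=; split_conj; lra.
  rewrite [X in _ + X + _]sub0; [|by measurable_tac|]; last first.
    by move=> x /= ?; rewrite /D /=; split_conj; lra.
  rewrite !addr0.
  by mass_ext.
have h1 := massT mu; rewrite -mass_unit_itv// in h1.
move: h1; rewrite (@mass_cut _ _ _ [set x : R | 0 <= x < 1 - alpha]) /=;
  [|by measurable_tac|by measurable_tac].
rewrite [X in X + _](_ : _ = mass [set x : R | 0 <= x < 1 - alpha]); last first.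
  by mass_ext.
rewrite [X in _ + X](_ : _ = mass D); last first.
  apply: eq_mass => x; rewrite /D /=; split=> ?; split_conj => //; last lra.
    by have [h|] := boolP (0 <= x < 1 - alpha); [tauto|lra].
  by move=> ?; lra.
(* Two pullbacks turn [0, 1 - alpha) into [0, 1 - 3 alpha), which is empty since alpha > 1/3. *)
rewrite D0 J0// J0; last by lra.
rewrite [X in X + _]mass_eq0; last by move=> x /=; lra.
by lra.
Qed.

(* [unzoom] is phi^-1, and [zoomed] the image under it of mu conditioned on
   [1 - alpha, 1). *)
Definition unzoom (x : borel R) : borel R := - ((1 - alpha) / alpha) + alpha^-1 * x.

Lemma measurable_unzoom : measurable_fun setT unzoom.
Proof. exact: measurable_fun_affine. Qed.

HB.instance Definition _ :=
  isMeasurableFun.Build _ _ _ _ unzoom measurable_unzoom.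

Lemma measurable_base :
  measurable ([set x : R | 1 - alpha <= x < 1] : set (borel R)).
Proof. by measurable_tac. Qed.

Definition zoomed : probability (borel R) R :=
  distribution (mnormalize (mrestr mu measurable_base) mu) unzoom.

Lemma alpha_unzoom x : alpha * unzoom x = x - (1 - alpha).
Proof. by rewrite /unzoom; field; rewrite gt_eqF. Qed.

Lemma zoomedE A : measurable A -> zoomed A =
  (mass [set x : R | 1 - alpha <= x < 1 /\ A (unzoom x)] /
   mass [set x : R | 1 - alpha <= x < 1])%:E.
Proof.
move=> mA; have b0 := mass_base_gt0.
have evE : mrestr mu measurable_base setT = (mass [set x : R | 1 - alpha <= x < 1])%:E.
  by rewrite /mrestr setTI massE//; exact: measurable_base.
transitivity (mnormalize (mrestr mu measurable_base) mu (unzoom @^-1` A)) => //.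
rewrite (mnormalizeE _ _ evE b0) /mrestr.
rewrite EFinM; congr (_ * _)%E; rewrite -massE.
  by congr (mu _); apply/seteqP; split=> x /= [].
apply: measurable_and_pred; first exact: measurable_base.
apply: measurable_comp_pred mA; exact: measurable_unzoom.
Qed.

Lemma unzoom_lt (x c : R) : (unzoom x < c) = (x < 1 - alpha + alpha * c).
Proof.
by rewrite -(ltr_pM2l alpha_gt0) alpha_unzoom ltrBlDl.
Qed.

Lemma unzoom_ge (x c : R) : (c <= unzoom x) = (1 - alpha + alpha * c <= x).
Proof. by rewrite leNgt unzoom_lt -leNgt. Qed.

(** The translations of the first-return map are beta = alpha alpha, alpha beta and alpha (beta -
    1); this rule turns them into the shifts alpha, beta and beta - 1 of S. *)
Lemma unzoomD (x c : R) : unzoom (x + alpha * c) = unzoom x + c.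
Proof. by rewrite /unzoom; field; rewrite gt_eqF. Qed.

Lemma itm_piece1 x : x < 1 - alpha -> itm alpha beta x = x + alpha.
Proof. by rewrite /itm => ->. Qed.

Lemma itm_piece2 x : 1 - alpha <= x < 1 - beta -> itm alpha beta x = x + beta.
Proof. by move=> /andP[h1 h2]; rewrite /itm ltNge h1 /= h2. Qed.

Lemma itm_piece3 x : 1 - beta <= x -> itm alpha beta x = x + beta - 1.
Proof.
have ab := alpha_bounds; have bb := beta_bounds => h; rewrite /itm.
by rewrite !ifF//; lra.
Qed.

(** The first-return map to the base preserves the restriction of [mu] by [mass_return], and it is
    conjugate to S by phi. The proof matches the three terms of [mass_return] with the three
    branches of S. *)
Lemma zoomed_invariant : Defs.invariant alpha beta zoomed.
Proof.
have ab := alpha_bounds; have bb := beta_bounds.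
have aB := alpha_beta; have aa := alpha_alpha.
have b0 := mass_base_gt0.
split=> [|B mB].
  rewrite zoomedE; last exact: measurable_itv.
  rewrite [X in X / _](_ : _ = mass [set x : R | 1 - alpha <= x < 1]).
    by rewrite divff// gt_eqF.
  apply: eq_mass => x /=; rewrite in_itv /= unzoom_ge unzoom_lt.
  by split=> ?; split_conj; lra.
have mI (a b : R) : measurable ([set x : R | a <= x < b] : set (borel R)).
  by measurable_tac.
have mS : measurable_fun setT (itm alpha beta : borel R -> borel R).
  apply: measurable_fun_ifT; first by apply: measurable_fun_ltr; measurable_fun_tac.
    by measurable_fun_tac.
  apply: measurable_fun_ifT; first by apply: measurable_fun_ltr; measurable_fun_tac.
    by measurable_fun_tac.
  by measurable_fun_tac.
have mSB : measurable ([set x | B (itm alpha beta x)] : set (borel R)).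
  exact: measurable_comp_pred.
have mz := measurable_unzoom.
have mu_ (f : borel R -> borel R) : measurable_fun setT f ->
    measurable_fun setT (fun x : borel R => unzoom (f x)).
  by move=> mf; exact: measurableT_comp.
rewrite !zoomedE//; last by apply: measurableI; [exact: measurable_itv|].
congr ((_ / _)%:E).
rewrite [RHS]mass_return; last exact: measurable_comp_pred.
set Z := (X in mass X = _).
have mZ : measurable (Z : set (borel R)).
  apply: measurable_and_pred; first exact: mI.
  apply: (measurable_comp_pred mz (B := _ `&` _)).
  by apply: measurableI; [exact: measurable_itv|].
have hZ x : Z x -> 1 - alpha <= x < 1 /\ B (itm alpha beta (unzoom x)).
  by case=> ? [].
have Zh x : 1 - alpha <= x < 1 -> B (itm alpha beta (unzoom x)) -> Z x.
  by move=> ? ?; do 2!split=> //; rewrite /= in_itv /= unzoom_ge unzoom_lt; lra.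
(* The cut 1 - beta = phi (1 - alpha) here, and 2 - 2 alpha - beta = phi (1 - beta) further down,
   separate the branches of S seen through [unzoom]. *)
rewrite (@mass_cut _ _ Z [set x : R | x < 1 - beta])//; last by measurable_tac.
rewrite -addrA; congr (_ + _).
  apply: eq_mass => x /=; rewrite -aa unzoomD.
  split=> [[? /hZ [?]]|[? ?]].
    by rewrite itm_piece1 ?unzoom_lt; last lra; split=> //; lra.
  split; first lra.
  by apply: Zh; [lra|rewrite itm_piece1 ?unzoom_lt; last lra].
rewrite (@mass_cut _ _ _ [set x : R | x + beta - 1 + alpha < 1 - alpha])//=;
  last 2 first.
- apply: measurable_and_pred => //; apply: measurableC; measurable_tac.
- by measurable_tac.
congr (_ + _).
  apply: eq_mass => x /=.
  rewrite (_ : x + beta - 1 + alpha + alpha = x + alpha * beta);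
    last by rewrite aB; ring.
  rewrite unzoomD.
  split=> [[? [? /hZ [?]]]|[? [? ?]]].
    by rewrite itm_piece2 ?unzoom_lt ?unzoom_ge; last lra; split=> //; lra.
  split=> //; split; first lra.
  by apply: Zh; [lra|rewrite itm_piece2 ?unzoom_lt ?unzoom_ge; last lra].
apply: eq_mass => x /=.
rewrite (_ : x + beta - 1 + alpha = x + alpha * (beta - 1));
  last by rewrite mulrBr aB; ring.
rewrite unzoomD addrA.
split=> [[? [? /hZ [?]]]|[? [? ?]]].
  rewrite itm_piece3 ?unzoom_ge; last lra.
  by split; [lra|split=> //; lra].
split; first lra.
split; first lra.
by apply: Zh; [lra|rewrite itm_piece3 ?unzoom_ge; last lra].
Qed.

Hypothesis mu_uniq : forall nu : probability (borel R) R,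
  Defs.invariant alpha beta nu ->
  forall B : set (borel R), measurable B -> nu B = mu B.

(** Unique invariance identifies [zoomed] with [mu]. The scaling factor is still unknown here. *)
Lemma mass_zoom_base A : measurable A ->
  mass [set x : R | 1 - alpha <= x < 1 /\ A x] =
  mass [set x : R | 1 - alpha <= x < 1] *
  mass [set x : R | 0 <= x < 1 /\ A (1 - alpha + alpha * x)].
Proof.
move=> mA; have b0 := mass_base_gt0.
pose B := [set x : R | A (1 - alpha + alpha * x)].
have mB : measurable (B : set (borel R)).
  by apply: (measurable_comp_pred _ mA); exact: measurable_fun_affine.
rewrite mass_unit_itv// -/B.
have := mu_uniq zoomed_invariant mB; rewrite zoomedE// massE// => -[<-].
rewrite mulrC divfK ?gt_eqF//; apply: eq_mass => x; rewrite /B /=.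
by rewrite alpha_unzoom [1 - alpha + _]addrC subrK.
Qed.

Lemma zoom_lt y c : (1 - alpha + alpha * y < 1 - alpha + alpha * c) = (y < c).
Proof. by rewrite ltrD2l ltr_pM2l. Qed.

Lemma zoom_le y c : (1 - alpha + alpha * y <= 1 - alpha + alpha * c) = (y <= c).
Proof. by rewrite lerD2l ler_pM2l. Qed.

(** * The mass of the base *)

Local Notation base_mass := (mass [set x : R | 1 - alpha <= x < 1]).

Lemma mass_piece2_zoom : mass [set x : R | 1 - alpha <= x < 1 - beta] =
  base_mass * mass [set x : R | 0 <= x < 1 - alpha].
Proof.
have ab := alpha_bounds; have bb := beta_bounds; have z1 := zoom_cut1.
transitivity (mass [set x : R | 1 - alpha <= x < 1 /\ x < 1 - beta]); first by mass_ext.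
rewrite mass_zoom_base; last by measurable_tac.
congr (_ * _); apply: eq_mass => x /=.
by rewrite z1 zoom_lt; split=> ?; split_conj => //; lra.
Qed.

Lemma mass_piece3_zoom : mass [set x : R | 1 - beta <= x < 1] = base_mass * base_mass.
Proof.
have ab := alpha_bounds; have bb := beta_bounds; have z1 := zoom_cut1.
transitivity (mass [set x : R | 1 - alpha <= x < 1 /\ 1 - beta <= x]); first by mass_ext.
rewrite mass_zoom_base; last by measurable_tac.
congr (_ * _); apply: eq_mass => x /=.
by rewrite z1 zoom_le; split=> ?; split_conj => //; lra.
Qed.

Lemma mass_piece1_base : 1 = mass [set x : R | 0 <= x < 1 - alpha] + base_mass.
Proof.
have ab := alpha_bounds.
rewrite -[LHS](massT mu) -mass_unit_itv; last exact: measurableT.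
rewrite (@mass_cut _ _ _ [set x : R | x < 1 - alpha]);
  [|by measurable_tac|by measurable_tac].
by congr (_ + _); mass_ext.
Qed.

(** I1 is reached from I3 and from [0, 1 - 2 alpha). The latter is reached only from [1 - beta, 2 -
    2 alpha - beta), which is phi of I2. This supplies a second equation between the masses of I1
    and of the base. *)
Lemma mass_piece1_return : mass [set x : R | 0 <= x < 1 - alpha] =
  base_mass * mass [set x : R | 1 - alpha <= x < 1 - beta] +
  mass [set x : R | 1 - beta <= x < 1].
Proof.
have ab := alpha_bounds; have bb := beta_bounds.
have z1 := zoom_cut1; have z2 := zoom_cut2.
rewrite mass_branches; last by measurable_tac.
rewrite [X in _ + X + _]mass_eq0 ?addr0; last by mass_empty.
congr (_ + _); last by mass_ext.
transitivity (mass [set x : R | 0 <= x < 1 - 2 * alpha]); first by mass_ext.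
rewrite mass_branches; last by measurable_tac.
rewrite [X in X + _ + _]mass_eq0 ?add0r; last by mass_empty.
rewrite [X in X + _]mass_eq0 ?add0r; last by mass_empty.
transitivity (mass [set x : R | 1 - alpha <= x < 1 /\
    1 - beta <= x < 2 - 2 * alpha - beta]); first by mass_ext.
rewrite mass_zoom_base; last by measurable_tac.
congr (_ * _); apply: eq_mass => x /=.
by rewrite z1 z2 zoom_le zoom_lt; split=> ?; split_conj => //; lra.
Qed.

(* m = mu([1 - alpha, 1)) and n = 1 - alpha are both roots in [0, 1] of the cubic
   x^3 - 2 x^2 - x + 1, which is decreasing on [0, 1]. *)
Lemma cubic_root_unique (m n : R) : 0 <= m <= 1 -> 0 < n <= 1 ->
  m * m * m - 2 * (m * m) - m + 1 = 0 ->
  n * n * n - 2 * (n * n) - n + 1 = 0 -> m = n.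
Proof.
move=> m01 n01 mroot nroot.
have : (m - n) * (m * m + m * n + n * n - 2 * (m + n) - 1) = 0 by lra.
have neg : m * m + m * n + n * n - 2 * (m + n) - 1 < 0.
  have mm : 0 <= m * (1 - m) by apply: mulr_ge0; lra.
  have nn : 0 <= n * (1 - n) by apply: mulr_ge0; lra.
  have mn : 0 <= m * (1 - n) by apply: mulr_ge0; lra.
  by lra.
by move=> /eqP; rewrite mulf_eq0 (lt_eqF neg) orbF subr_eq0 => /eqP.
Qed.

Lemma mass_base : base_mass = 1 - alpha.
Proof.
have ab := alpha_bounds.
have e1 := mass_piece1_base; have e2 := mass_piece1_return.
rewrite mass_piece2_zoom mass_piece3_zoom in e2.
have b0 := mass_ge0 mu [set x : R | 1 - alpha <= x < 1].
have p0 := mass_ge0 mu [set x : R | 0 <= x < 1 - alpha].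
move: b0 p0 e1 e2; move: base_mass => m; move: (mass _) => p b0 p0 e1 e2.
(* Once p is eliminated, [e2] reads 1 - m = m^2 (1 - m) + m^2, a cubic that 1 - alpha satisfies as
   well. *)
have pE : p = 1 - m by lra.
apply: cubic_root_unique; [lra|lra|by rewrite pE in e2; lra|].
by have := alpha_root; rewrite !exprS expr0; lra.
Qed.

(** * Masses of the pieces and of the gap *)

Variable q0 : R.
Hypothesis q0E : q0 = (1 - alpha) ^+ 2.

Lemma q0_lin : q0 = 1 - 2 * alpha + beta.
Proof. by rewrite q0E betaE; ring. Qed.

Lemma alpha_q0 : alpha * q0 = 3 * alpha - beta - 1.
Proof. by have := alpha_beta; have := alpha_alpha; rewrite q0_lin; lra. Qed.

Lemma onem_alpha_sq : (1 - alpha) * (1 - alpha) = q0.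
Proof. by rewrite q0E expr2. Qed.

Lemma mass_zoom A : measurable A ->
  mass [set x : R | 1 - alpha <= x < 1 /\ A x] =
  (1 - alpha) * mass [set x : R | 0 <= x < 1 /\ A (1 - alpha + alpha * x)].
Proof. by move=> mA; rewrite mass_zoom_base// mass_base. Qed.

Lemma mass_piece1 : mass [set x : R | 0 <= x < 1 - alpha] = alpha.
Proof. by have := mass_piece1_base; rewrite mass_base; lra. Qed.

Lemma mass_piece3 : mass [set x : R | 1 - beta <= x < 1] = q0.
Proof. by rewrite mass_piece3_zoom mass_base onem_alpha_sq. Qed.

Lemma mass_below_gap : mass [set x : R | 0 <= x < beta] = q0.
Proof.
have ab := alpha_bounds; have bb := beta_bounds.
rewrite mass_branches; last by measurable_tac.
rewrite [X in X + _ + _]mass_eq0 ?add0r; last by mass_empty.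
rewrite [X in X + _]mass_eq0 ?add0r; last by mass_empty.
by rewrite -mass_piece3; mass_ext.
Qed.

Lemma mass_gap : mass [set x : R | beta <= x < alpha] = 0.
Proof.
have ab := alpha_bounds; have bb := beta_bounds.
rewrite mass_branches; last by measurable_tac.
rewrite [X in X + _ + _]mass_eq0 ?add0r; last by mass_empty.
rewrite [X in X + _]mass_eq0 ?add0r; last by mass_empty.
by rewrite mass_eq0 //= => x /= ?; split_conj; lra.
Qed.

(** On I1 one has theta = S S phi phi: two steps back from [alpha, 1 - alpha), through the first and
    then the third branch, lead to phi (phi I1). Each of the two zooms contributes a factor 1 -
    alpha. *)
Lemma mass_above_gap A : measurable A ->
  mass [set x : R | alpha <= x < 1 - alpha /\ A x] =
  q0 * mass [set x : R | 0 <= x < 1 - alpha /\ A (alpha + beta * x)].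
Proof.
move=> mA.
have ab := alpha_bounds; have bb := beta_bounds.
have aB := alpha_beta; have aa := alpha_alpha.
have z1 := zoom_cut1.
have z2 := zoom_cut2.
transitivity (mass [set x : R | 0 <= x < 1 - 2 * alpha /\ A (x + alpha)]).
  rewrite mass_branches; last by measurable_tac.
  rewrite [X in _ + X]mass_eq0 ?addr0; last by mass_empty.
  rewrite [X in _ + X]mass_eq0 ?addr0; last by mass_empty.
  by mass_ext.
rewrite mass_branches; last by measurable_tac.
rewrite [X in X + _ + _]mass_eq0 ?add0r; last by mass_empty.
rewrite [X in X + _]mass_eq0 ?add0r; last by mass_empty.
transitivity (mass [set x : R | 1 - alpha <= x < 1 /\
    (1 - beta <= x < 2 - 2 * alpha - beta /\ A (x + beta - 1 + alpha))]).
  by mass_ext.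
rewrite mass_zoom; last by measurable_tac.
transitivity ((1 - alpha) * mass [set x : R | 1 - alpha <= x < 1 /\
    (x < 1 - beta /\ A (beta + alpha * x))]).
  congr (_ * _); apply: eq_mass => x /=.
  rewrite (_ : 1 - alpha + alpha * x + beta - 1 + alpha = beta + alpha * x);
    last by ring.
  by rewrite {1}z1 z2 zoom_le zoom_lt; split=> ?; split_conj => //; lra.
rewrite mass_zoom; last by measurable_tac.
rewrite mulrA onem_alpha_sq; congr (_ * _); apply: eq_mass => x /=.
rewrite (_ : beta + alpha * (1 - alpha + alpha * x) = alpha + beta * x);
  last by rewrite -aa; ring.
by rewrite z1 zoom_lt; split=> ?; split_conj => //; lra.
Qed.

Lemma mass_piece1_split A : measurable A ->
  mass [set x : R | 0 <= x < 1 - alpha /\ A x] =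
  mass [set x : R | 0 <= x < beta /\ A x] +
  q0 * mass [set x : R | 0 <= x < 1 - alpha /\ A (alpha + beta * x)].
Proof.
move=> mA; have ab := alpha_bounds; have bb := beta_bounds.
rewrite -mass_above_gap//.
rewrite (@mass_cut _ _ _ [set x : R | x < beta]);
  [|by measurable_tac|by measurable_tac].
congr (_ + _); first by mass_ext.
rewrite (@mass_cut _ _ _ [set x : R | x < alpha]); [| |by measurable_tac]; last first.
  by apply: measurable_and_pred; [apply: measurableC|]; measurable_tac.
rewrite [X in X + _](_ : _ = 0) ?add0r.
  by mass_ext.
apply/eqP; rewrite eq_le mass_ge0 andbT -mass_gap; apply: le_mass.
- apply: measurable_and_pred; first by measurable_tac.
  by apply: measurable_and_pred; [apply: measurableC|]; measurable_tac.
- by measurable_tac.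
- by mass_empty.
Qed.

(** * The distribution function *)

Hypothesis mu_diffuse : forall x : R, mass [set x] = 0.
Local Notation h := (distr_fun mu).

Lemma distr_funE x : h x = mass [set z : R | 0 <= z <= x].
Proof.
by congr (fine (mu _)); apply/seteqP; split=> z /=; rewrite in_itv.
Qed.

Lemma distr_fun_unit x : h x = mass [set z : R | 0 <= z < 1 /\ z <= x].
Proof.
rewrite distr_funE -mass_unit_itv; last by measurable_tac.
by mass_ext.
Qed.

(** Points are null, so the right endpoint may be dropped. *)
Lemma distr_fun_open x : h x = mass [set z : R | 0 <= z < x].
Proof.
rewrite distr_funE (@mass_cut _ _ _ [set z : R | z < x]);
  [|by measurable_tac|by measurable_tac].
rewrite [X in _ + X](_ : _ = 0) ?addr0.
  by mass_ext.
apply/eqP; rewrite eq_le mass_ge0 andbT -(mu_diffuse x); apply: le_mass.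
- by apply: measurable_and_pred; [apply: measurableC|]; measurable_tac.
- by measurable_tac.
- by move=> z /= ?; split_conj; apply: le_anti; lra.
Qed.

Lemma le_distr_fun x y : x <= y -> h x <= h y.
Proof.
move=> xy; rewrite !distr_funE; apply: le_mass.
- by measurable_tac.
- by measurable_tac.
- by move=> z /=; lra.
Qed.

Lemma measurable_distr_fun : measurable_fun setT (h : borel R -> borel R).
Proof. by apply: nondecreasing_measurable => // x y; exact: le_distr_fun. Qed.

Lemma lt_distr_fun x y : h x < h y -> x < y.
Proof. by rewrite !ltNge; apply: contra => /le_distr_fun. Qed.

Lemma distr_fun_ge0 x : 0 <= h x. Proof. exact: mass_ge0. Qed.

Lemma distr_fun_ge1 x : 1 <= x -> h x = 1.
Proof.
move=> x1; rewrite -(massT mu) -mass_unit_itv; last exact: measurableT.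
by rewrite distr_fun_unit; mass_ext.
Qed.

Lemma distr_fun_le1 x : h x <= 1.
Proof.
have [/distr_fun_ge1 ->//|/ltW x1] := leP 1 x.
by rewrite -[leRHS](@distr_fun_ge1 1)// le_distr_fun.
Qed.

Lemma distr_fun_le0 x : x <= 0 -> h x = 0.
Proof.
by move=> x0; rewrite distr_fun_open mass_eq0// => z /=; lra.
Qed.

Lemma distr_fun_cut1 : h (1 - alpha) = alpha.
Proof. by rewrite distr_fun_open mass_piece1. Qed.

Lemma distr_fun_cut2 : h (1 - beta) = 2 * alpha - beta.
Proof.
have ab := alpha_bounds; have bb := beta_bounds; have qE := q0_lin.
suff : 1 = h (1 - beta) + q0 by lra.
rewrite distr_fun_open -mass_piece3 -[LHS](massT mu).
rewrite -mass_unit_itv; last exact: measurableT.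
rewrite (@mass_cut _ _ _ [set x : R | x < 1 - beta]);
  [|by measurable_tac|by measurable_tac].
by congr (_ + _); mass_ext.
Qed.

Lemma distr_fun_gap x : beta <= x <= alpha -> h x = q0.
Proof.
have ab := alpha_bounds; have bb := beta_bounds.
move=> /andP[bx xa].
have hb : h beta = q0 by rewrite distr_fun_open mass_below_gap.
have ha : h alpha = q0.
  rewrite distr_fun_open (@mass_cut _ _ _ [set x : R | x < beta]);
    [|by measurable_tac|by measurable_tac].
  rewrite -[RHS]addr0 -[X in _ = _ + X]mass_gap -[X in _ = X + _]mass_below_gap.
  by congr (_ + _); mass_ext.
by have := le_distr_fun bx; have := le_distr_fun xa; rewrite ha hb => ? ?; lra.
Qed.

Lemma distr_fun_zoom y : 0 <= y ->
  h (1 - alpha + alpha * y) = alpha + (1 - alpha) * h y.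
Proof.
move=> y0; have ab := alpha_bounds; have bb := beta_bounds.
have ay : 0 <= alpha * y by apply: mulr_ge0 => //; lra.
rewrite distr_fun_unit [in RHS]distr_fun_unit.
rewrite (@mass_cut _ _ _ [set x : R | x < 1 - alpha]);
  [|by measurable_tac|by measurable_tac].
rewrite -[X in _ = X + _]mass_piece1; congr (_ + _).
  by mass_ext.
transitivity (mass [set z : R | 1 - alpha <= z < 1 /\ z <= 1 - alpha + alpha * y]).
  by mass_ext.
rewrite mass_zoom; last by measurable_tac.
by congr (_ * _); apply: eq_mass => z /=; rewrite zoom_le.
Qed.

Lemma distr_fun_above_gap y : 0 <= y <= 1 - alpha ->
  h (alpha + beta * y) = q0 + q0 * h y.
Proof.
move=> /andP[y0 y1]; have ab := alpha_bounds; have bb := beta_bounds.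
have aB := alpha_beta.
have b0 : 0 < beta by lra.
have ay : 0 <= beta * y by apply: mulr_ge0 => //; lra.
have ay1 : beta * y <= beta * (1 - alpha) by rewrite ler_pM2l.
rewrite distr_fun_open.
transitivity (mass [set z : R | 0 <= z < 1 - alpha /\ z < alpha + beta * y]).
  by mass_ext.
rewrite mass_piece1_split; last by measurable_tac.
rewrite -[X in _ = X + _]mass_below_gap [in RHS]distr_fun_open; congr (_ + _ * _).
  by mass_ext.
by apply: eq_mass => z /=; rewrite ltrD2l ltr_pM2l//; split=> ?; split_conj => //; lra.
Qed.

(** * The overlap of the first two branches *)

(* The law of h (psi y) under mu restricted to the first piece. *)
Definition jump_law (E : set R) : R :=
  mass [set y : R | 0 <= y < 1 - alpha /\ E (h (q0 + alpha * y))].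

Lemma measurable_jump E : measurable (E : set (borel R)) ->
  measurable ([set y : R | E (h (q0 + alpha * y))] : set (borel R)).
Proof.
move=> mE; apply: (@measurable_comp_pred _ (fun y : borel R => h (q0 + alpha * y))) mE.
apply: measurableT_comp; [exact: measurable_distr_fun|exact: measurable_fun_affine].
Qed.

(** On [0, beta) the map psi lands in the gap, where h = q0; the remaining mass of I1 is carried by
    theta, which commutes with psi. The law is therefore a mass q0 at the point q0 plus q0 times its
    own image under w |-> q0 + q0 w. *)
Lemma jump_lawE E : measurable (E : set (borel R)) ->
  jump_law E = mass [set y : R | 0 <= y < beta /\ E q0] +
    q0 * jump_law [set w | E (q0 + q0 * w)].
Proof.
move=> mE.
have ab := alpha_bounds; have bb := beta_bounds.
have aB := alpha_beta; have aa := alpha_alpha; have qE := q0_lin.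
have aq := alpha_q0.
rewrite /jump_law mass_piece1_split; last exact: measurable_jump.
congr (_ + _ * _).
  apply: eq_mass => y /=; split=> -[yb]; rewrite distr_fun_gap//.
    have : 0 <= alpha * y < alpha * beta.
      by rewrite mulr_ge0 ?ltr_pM2l//; lra.
    by lra.
  have : 0 <= alpha * y < alpha * beta.
    by rewrite mulr_ge0 ?ltr_pM2l//; lra.
  by lra.
apply: eq_mass => y /=.
(* This is psi theta = theta psi, which amounts to beta q0 = q0 + beta - alpha. *)
have -> : q0 + alpha * (alpha + beta * y) = alpha + beta * (q0 + alpha * y).
  have e1 : alpha * alpha = beta by [].
  have : beta * q0 = q0 + beta - alpha.
    rewrite -aa -mulrA aq; lra.
  lra.
split=> -[y01]; rewrite distr_fun_above_gap//.
  have : 0 <= alpha * y < alpha * (1 - alpha).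
    by rewrite mulr_ge0 ?ltr_pM2l//; lra.
  by lra.
have : 0 <= alpha * y < alpha * (1 - alpha).
  by rewrite mulr_ge0 ?ltr_pM2l//; lra.
by lra.
Qed.

(* Indices are shifted by one: [jump_value r.+1] is u_r, and [jump_value 0] = 0. *)
Definition jump_value (r : nat) : R := alpha * (1 - q0 ^+ r).

Lemma q0_bounds : 1 / 4 < q0 < 2 / 5.
Proof.
by have ab := alpha_bounds; have bb := beta_bounds; have qE := q0_lin; lra.
Qed.

Lemma jump_value0 : jump_value 0 = 0.
Proof. by rewrite /jump_value expr0 subrr mulr0. Qed.

(** [alpha] is the fixed point of w |-> q0 + q0 w, since alpha q0 = alpha - q0; the distance to it
    shrinks by the factor q0 at each step. *)
Lemma jump_valueS r : jump_value r.+1 = q0 + q0 * jump_value r.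
Proof.
have e : alpha * q0 = alpha - q0 by rewrite alpha_q0 q0_lin; ring.
rewrite /jump_value exprS !mulrBr !mulr1 !mulrA e [q0 * alpha]mulrC e.
by ring.
Qed.

Lemma jump_value_ge0 r : 0 <= jump_value r.
Proof.
have qb := q0_bounds; elim: r => [|r IH]; first by rewrite jump_value0.
have q0r : 0 <= q0 * jump_value r by apply: mulr_ge0 => //; lra.
by rewrite jump_valueS; lra.
Qed.

Lemma lt_jump_valueS r : jump_value r < jump_value r.+1.
Proof.
have qb := q0_bounds.
elim: r => [|r IH]; first by rewrite jump_valueS jump_value0; lra.
by rewrite jump_valueS [ltRHS]jump_valueS ltrD2l ltr_pM2l//; lra.
Qed.

Lemma jump_value_lt_alpha r : jump_value r < alpha.
Proof.
have qb := q0_bounds; have ab := alpha_bounds.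
rewrite /jump_value -[ltRHS]mulr1 ltr_pM2l// ltrBlDr ltrDl exprn_gt0//; lra.
Qed.

Lemma jump_law_eq0 E : (forall w, 0 <= w -> ~ E w) -> jump_law E = 0.
Proof. by move=> E0; apply: mass_eq0 => y /= [_] /E0; apply; exact: distr_fun_ge0. Qed.

Lemma eq_jump_law E F : (forall w, E w <-> F w) -> jump_law E = jump_law F.
Proof. by move=> EF; apply: eq_mass => y /=; rewrite EF. Qed.

Lemma jump_law_ge0 E : 0 <= jump_law E.
Proof. exact: mass_ge0. Qed.

Lemma mass_below_gapT (P : Prop) : P -> mass [set y : R | 0 <= y < beta /\ P] = q0.
Proof. by move=> p; rewrite -mass_below_gap; apply: eq_mass => y /=; tauto. Qed.

Lemma mass_below_gapF (P : Prop) : ~ P -> mass [set y : R | 0 <= y < beta /\ P] = 0.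
Proof. by move=> p; rewrite mass_eq0// => y /=; tauto. Qed.

(** Under [jump_lawE] the cumulative masses satisfy the recursion of the values themselves, with the
    same start at 0. Hence the same number on both sides. *)
Lemma jump_law_le r : jump_law [set w | w <= jump_value r] = jump_value r.
Proof.
have qb := q0_bounds; have q0p : 0 < q0 by lra.
elim: r => [|r IH]; rewrite jump_lawE; try by measurable_tac.
  rewrite jump_value0 mass_below_gapF /=; last by lra.
  rewrite jump_law_eq0 ?mulr0 ?addr0// => w w0 /=.
  by have := mulr_ge0 (ltW q0p) w0; lra.
have jr := jump_value_ge0 r.
rewrite mass_below_gapT /=; last first.
  by rewrite jump_valueS lerDl mulr_ge0// ltW.
rewrite jump_valueS -[in RHS]IH; congr (_ + _ * _).
by apply: eq_jump_law => w /=; rewrite lerD2l ler_pM2l.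
Qed.

(** The recursion of [jump_law_le], delayed by one index: the mass at q0 = [jump_value 1] is not yet
    counted at the first strict inequality. With [jump_law_le] this makes the gaps between
    consecutive values null. *)
Lemma jump_law_lt r : jump_law [set w | w < jump_value r.+1] = jump_value r.
Proof.
have qb := q0_bounds; have q0p : 0 < q0 by lra.
elim: r => [|r IH]; rewrite jump_lawE; try by measurable_tac.
  rewrite jump_valueS jump_value0 mulr0 addr0 mass_below_gapF /= ?ltxx//.
  rewrite jump_law_eq0 ?mulr0 ?addr0// => w w0 /=.
  by have := mulr_ge0 (ltW q0p) w0; lra.
rewrite mass_below_gapT /=; last first.
  rewrite jump_valueS ltrDl mulr_gt0//.
  by apply: le_lt_trans (lt_jump_valueS r); exact: jump_value_ge0.
rewrite [RHS]jump_valueS -[in RHS]IH; congr (_ + _ * _).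
by apply: eq_jump_law => w /=; rewrite [in X in X <-> _]jump_valueS ltrD2l ltr_pM2l.
Qed.

Lemma jump_law_atom r : 0 < jump_law [set jump_value r.+1].
Proof.
have qb := q0_bounds; have q0p : 0 < q0 by lra.
elim: r => [|r IH]; rewrite jump_lawE; try exact: measurable_set1.
  rewrite mass_below_gapT /=; last by rewrite jump_valueS jump_value0; lra.
  by apply: ltr_wpDr => //; apply: mulr_ge0; [exact: ltW|exact: jump_law_ge0].
apply: ltr_wpDl; first exact: mass_ge0.
apply: mulr_gt0 => //; apply: lt_le_trans IH _; rewrite le_eqVlt; apply/orP; left.
apply/eqP; apply: eq_jump_law => w /=; rewrite (jump_valueS r.+1).
by split=> [->//|/addrI/mulfI]; apply; rewrite gt_eqF.
Qed.

(** No mass lies strictly between consecutive values, so the lower and the upper bound on A have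
    equal mass. This evaluates the overlap terms of [distr_fun_itm1] and [distr_fun_itm2] away from
    the cuts. *)
Lemma jump_law_sandwich A r : measurable A ->
  (forall y, 0 <= y < 1 - alpha -> h (q0 + alpha * y) <= jump_value r -> A y) ->
  (forall y, 0 <= y < 1 - alpha -> A y -> h (q0 + alpha * y) < jump_value r.+1) ->
  mass [set y : R | 0 <= y < 1 - alpha /\ A y] = jump_value r.
Proof.
move=> mA lA Al; apply/eqP; rewrite eq_le; apply/andP; split.
  rewrite -[leRHS]jump_law_lt; apply: le_mass.
  - by measurable_tac.
  - apply: measurable_and_pred; first by measurable_tac.
    by apply: measurable_jump; measurable_tac.
  - by move=> y /= [y01 Ay]; split=> //; exact: Al.
rewrite -[leLHS]jump_law_le; apply: le_mass.
- apply: measurable_and_pred; first by measurable_tac.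
  by apply: measurable_jump; measurable_tac.
- by measurable_tac.
- by move=> y /= [y01 Ay]; split=> //; exact: lA.
Qed.

Lemma jump_law_gap r : jump_law [set w | jump_value r < w < jump_value r.+1] = 0.
Proof.
have := jump_law_lt r; rewrite /jump_law.
rewrite (@mass_cut _ _ _ [set y : R | h (q0 + alpha * y) <= jump_value r]);
  [|apply: measurable_and_pred; first (by measurable_tac)|]; last 2 first.
- by apply: (@measurable_jump [set w | w < _]); measurable_tac.
- by apply: (@measurable_jump [set w | w <= _]); measurable_tac.
have lt1 := lt_jump_valueS r.
rewrite [X in X + _](_ : _ = jump_value r).
  move=> e; transitivity (mass [set x : R | ~ h (q0 + alpha * x) <= jump_value r /\
      (0 <= x < 1 - alpha /\ h (q0 + alpha * x) < jump_value r.+1)]).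
    by mass_ext.
  by move: e => /=; lra.
rewrite -[RHS]jump_law_le; apply: eq_mass => y /=.
by split=> ?; split_conj => //; lra.
Qed.

(** Pull [0, x + alpha] back: the first branch gives h x, the third all of I3, and the second, after
    zooming, the points y of I1 with psi y <= x. *)
Lemma distr_fun_itm1 x : 0 <= x < 1 - alpha ->
  h (x + alpha) = h x + q0 +
    (1 - alpha) * mass [set y : R | 0 <= y < 1 - alpha /\ q0 + alpha * y <= x].
Proof.
move=> x01; have ab := alpha_bounds; have bb := beta_bounds; have aa := alpha_alpha.
have z1 := zoom_cut1.
have qE := q0_lin.
rewrite [LHS]distr_funE mass_branches; last by measurable_tac.
rewrite -addrA [X in _ + X]addrC -[X in _ = _ + X + _]mass_piece3 addrA.
congr (_ + _ + _).
- by rewrite distr_funE; mass_ext.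
- by mass_ext.
transitivity (mass [set z : R | 1 - alpha <= z < 1 /\
   (z < 1 - beta /\ z + beta <= x + alpha)]).
  by mass_ext.
rewrite mass_zoom; last by measurable_tac.
congr (_ * _); apply: eq_mass => y /=.
by rewrite z1 zoom_lt; split=> ?; split_conj => //; lra.
Qed.

(** Here [0, x + beta] pulls back to all of I3, to the part of I2 up to x, of mass h x - alpha, and
    to a part of I1. That part contains [0, beta), and above the gap it consists of the theta y with
    phi (psi y) <= x. *)
Lemma distr_fun_itm2 x : 1 - alpha <= x < 1 - beta ->
  h (x + beta) = h x + (2 * q0 - alpha) +
    q0 * mass [set y : R | 0 <= y < 1 - alpha /\
                           1 - alpha + alpha * (q0 + alpha * y) <= x].
Proof.
move=> x01; have ab := alpha_bounds; have bb := beta_bounds; have aa := alpha_alpha.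
have aq := alpha_q0.
rewrite [LHS]distr_funE mass_branches; last by measurable_tac.
rewrite mass_piece1_split; last by measurable_tac.
rewrite [X in X + _ + _ + _](_ : _ = q0); last first.
  by rewrite -mass_below_gap; mass_ext.
rewrite [X in _ + X](_ : _ = q0); last first.
  by rewrite -mass_piece3; mass_ext.
have -> : h x = alpha + mass [set z : R | 1 - alpha <= z < 1 - beta /\ z <= x].
  rewrite distr_funE (@mass_cut _ _ _ [set z : R | z < 1 - alpha]);
    [|by measurable_tac|by measurable_tac].
  rewrite -[X in _ = X + _]mass_piece1.
  by congr (_ + _); mass_ext.
have -> : mass [set z : R | 1 - alpha <= z < 1 - beta /\ z <= x] =
    mass [set z : R | 1 - alpha <= z < 1 - beta /\ 0 <= z + beta <= x + beta].
  by mass_ext.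
have -> : mass [set y : R | 0 <= y < 1 - alpha /\
      1 - alpha + alpha * (q0 + alpha * y) <= x] =
    mass [set y : R | 0 <= y < 1 - alpha /\
      0 <= alpha + beta * y + alpha <= x + beta].
  apply: eq_mass => y /=.
  rewrite (_ : 1 - alpha + alpha * (q0 + alpha * y) = 2 * alpha - beta + beta * y).
    split=> -[y01 yx]; split=> //; last by lra.
    have : 0 <= beta * y by apply: mulr_ge0; lra.
    by lra.
  by rewrite mulrDr aq mulrA aa; ring.
by rewrite /=; lra.
Qed.

Lemma distr_fun_itm3 x : 1 - beta <= x < 1 ->
  h (x + beta - 1) = h x - (2 * alpha - beta).
Proof.
move=> x01; have ab := alpha_bounds; have bb := beta_bounds.
suff : h x = 2 * alpha - beta + h (x + beta - 1) by lra.
have -> : h (x + beta - 1) = mass [set z : R | 1 - beta <= z < 1 /\ z <= x].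
  rewrite distr_funE mass_branches; last by measurable_tac.
  rewrite [X in X + _ + _]mass_eq0 ?add0r; last by mass_empty.
  rewrite [X in X + _]mass_eq0 ?add0r; last by mass_empty.
  by mass_ext.
rewrite distr_funE (@mass_cut _ _ _ [set z : R | z < 1 - beta]);
  [|by measurable_tac|by measurable_tac].
rewrite -[X in _ = X + _]distr_fun_cut2 distr_fun_open.
by congr (_ + _); mass_ext.
Qed.

Lemma measurable_distr_pre E : measurable (E : set (borel R)) ->
  measurable ([set x : R | E (h x)] : set (borel R)).
Proof. exact: (@measurable_comp_pred _ h _ measurable_distr_fun). Qed.

(** * The defect cut set *)

Lemma distr_defectE k (E : set R) (a b c d : R) : measurable (E : set (borel R)) ->
  (cuts alpha beta)`_k = a -> (cuts alpha beta)`_k.+1 = b ->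
  (shifts alpha beta)`_k = c ->
  mass [set z : R | a <= z - c < b /\ E (h (z - c))] =
    mass [set x : R | a <= x < b /\ E (h x)] + d ->
  distr_defect alpha beta mu k E = d%:E.
Proof.
move=> mE ea eb ec ed; have mh := measurable_distr_pre mE.
rewrite /distr_defect /defect /piece ea eb ec translate_preimage.
have -> : distr_fun mu @^-1` E `&` `[a, b[%classic =
    [set x : R | a <= x < b /\ E (h x)].
  by apply/seteqP; split=> x /=; rewrite in_itv => -[].
rewrite !massE; [|by measurable_tac|]; last first.
  apply: (@measurable_comp_pred _ (fun z : borel R => z - c : borel R)
    [set x : R | a <= x < b /\ E (h x)]); last by measurable_tac.
  exact: measurable_fun_translate.
by rewrite -EFinB ed addrAC subrr add0r.
Qed.

(** The first-branch preimage of a translated set B is B itself and cancels. The surplus comes from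
    the second branch: the points phi y with psi y in B. *)
Lemma distr_defect1 (E : set R) : measurable (E : set (borel R)) ->
  distr_defect alpha beta mu 0 E = ((1 - alpha) * jump_law E)%:E.
Proof.
move=> mE; have mh := measurable_distr_pre mE.
have ab := alpha_bounds; have bb := beta_bounds; have aa := alpha_alpha.
have qE := q0_lin.
have z1 := zoom_cut1.
apply: (distr_defectE (a := 0) (b := 1 - alpha) (c := alpha)) => //.
have mhc c : measurable ([set z : R | E (h (z - c))] : set (borel R)).
  apply: (@measurable_comp_pred _ (fun z : borel R => z - c : borel R) _ _ mh).
  exact: measurable_fun_translate.
rewrite mass_branches; last by have := mhc alpha; measurable_tac.
rewrite [X in _ + X]mass_eq0 ?addr0; last by mass_empty.
congr (_ + _).
  apply: eq_mass => x /=; rewrite addrK.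
  by split=> ?; split_conj => //; lra.
transitivity (mass [set x : R | 1 - alpha <= x < 1 /\
  (x < 1 - beta /\ (0 <= x + beta - alpha < 1 - alpha /\ E (h (x + beta - alpha))))]).
  by mass_ext.
rewrite mass_zoom; last first.
  apply: measurable_and_pred; first by measurable_tac.
  apply: measurable_and_pred; first by measurable_tac.
  by apply: (@measurable_comp_pred _ (fun x : borel R => x + beta : borel R) _
    (measurable_fun_translate beta) (mhc alpha)).
congr (_ * _); apply: eq_mass => y /=.
rewrite (_ : 1 - alpha + alpha * y + beta - alpha = q0 + alpha * y);
  last by rewrite qE; ring.
rewrite {1}z1 zoom_lt; split=> ?; split_conj => //; try lra.
have : 0 <= alpha * y < alpha * (1 - alpha) by rewrite mulr_ge0 ?ltr_pM2l//; lra.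
by lra.
Qed.

(** Now the surplus comes from the first branch. It lies above the gap, at points theta y, and S
    (theta y) - beta = phi (psi y); the affine map of values is h phi = alpha + (1 - alpha) h. *)
Lemma distr_defect2 (E : set R) : measurable (E : set (borel R)) ->
  distr_defect alpha beta mu 1 E =
  (q0 * jump_law [set w | E (alpha + (1 - alpha) * w)])%:E.
Proof.
move=> mE; have mh := measurable_distr_pre mE.
have ab := alpha_bounds; have bb := beta_bounds; have aa := alpha_alpha.
have aB := alpha_beta; have aq := alpha_q0; have qE := q0_lin.
apply: (distr_defectE (a := 1 - alpha) (b := 1 - beta) (c := beta)) => //.
have mhc c : measurable ([set z : R | E (h (z - c))] : set (borel R)).
  apply: (@measurable_comp_pred _ (fun z : borel R => z - c : borel R) _ _ mh).
  exact: measurable_fun_translate.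
rewrite mass_branches; last by have := mhc beta; measurable_tac.
rewrite [X in _ + X]mass_eq0 ?addr0; last by mass_empty.
rewrite addrC; congr (_ + _).
  apply: eq_mass => x /=; rewrite addrK.
  by split=> ?; split_conj => //; lra.
rewrite mass_piece1_split; last first.
  by apply: (@measurable_comp_pred _ (fun x : borel R => x + alpha : borel R)
    [set x : R | 1 - alpha <= x - beta < 1 - beta /\ E (h (x - beta))]
    (measurable_fun_translate alpha)); have := mhc beta; measurable_tac.
rewrite [X in X + _]mass_eq0 ?add0r; last by mass_empty.
congr (_ * _); apply: eq_mass => y /=.
have e : alpha + beta * y + alpha - beta = 1 - alpha + alpha * (q0 + alpha * y).
  by rewrite mulrDr aq mulrA aa; ring.
split=> -[y01].
  move=> [_]; rewrite e distr_fun_zoom//.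
  have : 0 <= alpha * y by apply: mulr_ge0; lra.
  by lra.
have : 0 <= beta * y < beta * (1 - alpha) by rewrite mulr_ge0 ?ltr_pM2l//; lra.
move=> yb; rewrite -distr_fun_zoom; last first.
  have : 0 <= alpha * y by apply: mulr_ge0; lra.
  by lra.
by rewrite -e => ?; split=> //; split=> //; lra.
Qed.

Lemma distr_defect3 (E : set R) : measurable (E : set (borel R)) ->
  distr_defect alpha beta mu 2 E = 0%E.
Proof.
move=> mE; have mh := measurable_distr_pre mE.
have ab := alpha_bounds; have bb := beta_bounds.
apply: (distr_defectE (a := 1 - beta) (b := 1) (c := beta - 1)) => //.
have mhc c : measurable ([set z : R | E (h (z - c))] : set (borel R)).
  apply: (@measurable_comp_pred _ (fun z : borel R => z - c : borel R) _ _ mh).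
  exact: measurable_fun_translate.
rewrite mass_branches; last by have := mhc (beta - 1); measurable_tac.
rewrite [X in X + _ + _]mass_eq0 ?add0r; last by mass_empty.
rewrite [X in X + _]mass_eq0 ?add0r ?addr0; last by mass_empty.
apply: eq_mass => x /=; rewrite (_ : x + beta - 1 - (beta - 1) = x); last by ring.
by split=> ?; split_conj => //; lra.
Qed.

Lemma cut_uE r : cut_u alpha q0 r = jump_value r.+1.
Proof. by []. Qed.

Lemma cut_vE r : cut_v alpha beta q0 r = alpha + (1 - alpha) * jump_value r.+1.
Proof. by rewrite /cut_v /jump_value -alpha_alpha; ring. Qed.

Lemma jump_value_cofinal t : t < alpha -> exists n, t < jump_value n.
Proof.
move=> ta; have qb := q0_bounds; have ab := alpha_bounds.
have q1 : `|q0| < 1 by rewrite ger0_norm; lra.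
have e0 : 0 < alpha - t by lra.
have /cvgrPdist_lt/(_ _ e0) := cvg_expr q1.
move=> [n _ /(_ n (leqnn n))]; rewrite /= sub0r normrN ger0_norm; last first.
  by apply: exprn_ge0; lra.
move=> qn; exists n; rewrite /jump_value.
have qn0 : 0 <= q0 ^+ n by apply: exprn_ge0; lra.
have : alpha * q0 ^+ n <= q0 ^+ n by rewrite ler_piMl//; lra.
by lra.
Qed.

Lemma jump_value_bracket t : 0 <= t < alpha ->
  exists r, jump_value r <= t < jump_value r.+1.
Proof.
move=> /andP[t0 ta]; apply: bracket; first by rewrite jump_value0.
exact: jump_value_cofinal.
Qed.

Lemma jump_law_gt_alpha : jump_law [set w | alpha < w] = 0.
Proof.
have ab := alpha_bounds; have bb := beta_bounds.
have aa := alpha_alpha; have qE := q0_lin.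
apply: mass_eq0 => y /= [y01]; apply/negP; rewrite -leNgt -[leRHS]distr_fun_cut1.
apply: le_distr_fun.
have : 0 <= alpha * y < alpha * (1 - alpha) by rewrite mulr_ge0 ?ltr_pM2l//; lra.
by lra.
Qed.

(** The open gaps between consecutive values are null, as are the half-lines below 0 and above
    alpha. An inclusion suffices: 0 and alpha are already cuts, as values of h at 0 and 1 -
    alpha. *)
Lemma jump_support w : (forall U : set R, open U -> U w -> 0 < jump_law U) ->
  w = 0 \/ w = alpha \/ exists r, w = jump_value r.+1.
Proof.
move=> supp.
have w0 : 0 <= w.
  rewrite leNgt; apply/negP => w0.
  have := supp [set x | x < 0] (@num_normedtype.open_lt R 0) w0.
  by rewrite jump_law_eq0 ?ltxx// => x x0 /=; lra.
have wa : w <= alpha.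
  rewrite leNgt; apply/negP => wa.
  have := supp [set x | alpha < x] (@num_normedtype.open_gt R alpha) wa.
  by rewrite jump_law_gt_alpha ltxx.
have [/eqP wE|wNa] := boolP (w == alpha); first by right; left.
have [r /andP[]] : exists r, jump_value r <= w < jump_value r.+1.
  by apply: jump_value_bracket; rewrite w0/= lt_neqAle wNa.
rewrite le_eqVlt => /orP[/eqP <- _|rw wr].
  by case: r => [|r]; [left; rewrite jump_value0|right; right; exists r].
have oI : open [set x | jump_value r < x < jump_value r.+1].
  rewrite (_ : [set x | _] = `]jump_value r, jump_value r.+1[%classic).
    exact: interval_open.
  by apply/seteqP; split=> x /=; rewrite in_itv.
by have := supp _ oI; rewrite jump_law_gap ltxx /= rw wr => /(_ isT).
Qed.

Lemma le_jump_law (E F : set R) : measurable (E : set (borel R)) ->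
  measurable (F : set (borel R)) -> (E `<=` F) -> jump_law E <= jump_law F.
Proof.
move=> mE mF EF; apply: le_mass.
- by apply: measurable_and_pred; [measurable_tac|exact: measurable_jump].
- by apply: measurable_and_pred; [measurable_tac|exact: measurable_jump].
- by move=> y /= [? /EF].
Qed.

(** The cuts of S give the four isolated terms of the formula, and the atoms of the jump law put
    every u_r and v_r in a support. Conversely [jump_support] confines the first two supports, and
    the third is empty because its measure vanishes. *)
Lemma defect_cut_setE : defect_cut_set alpha beta mu =
  [set 0; 1; alpha; 2 * alpha - beta]
    `|` range (cut_u alpha q0) `|` range (cut_v alpha beta q0).
Proof.
have ab := alpha_bounds; have bb := beta_bounds; have aa := alpha_alpha.
have qb := q0_bounds; have q0p : 0 < q0 by lra.
have a1 : 0 < 1 - alpha by lra.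
have mA (U : set R) : measurable (U : set (borel R)) ->
    measurable ([set w | U (alpha + (1 - alpha) * w)] : set (borel R)).
  exact: (measurable_comp_pred (measurable_fun_affine _ _)).
have cE : distr_fun mu @` [set` cuts alpha beta] = [set 0; 1; alpha; 2 * alpha - beta].
  have h0 := distr_fun_le0 (lexx 0); have h1 := distr_fun_ge1 (lexx 1).
  have hc1 := distr_fun_cut1; have hc2 := distr_fun_cut2.
  apply/seteqP; split=> u /=.
    move=> [x]; rewrite /= !inE => /or4P[]/eqP-> <-; rewrite ?h0 ?h1 ?hc1 ?hc2; tauto.
  move=> [[[->|->]|->]|->].
  - by exists 0; rewrite ?h0// !inE eqxx.
  - by exists 1; rewrite ?h1// !inE eqxx !orbT.
  - by exists (1 - alpha); rewrite ?hc1// !inE eqxx !orbT.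
  - by exists (1 - beta); rewrite ?hc2// !inE eqxx !orbT.
rewrite /defect_cut_set cE; apply/seteqP; split=> u /=; last first.
  case; first case; first by left.
    move=> [r _ <-]; right; exists 0%N => //= U oU Uu; have mU := open_measurable oU.
    rewrite distr_defect1// lte_fin mulr_gt0//.
    apply: lt_le_trans (jump_law_atom r) _.
    by apply: (le_jump_law (measurable_set1 _) mU) => x ->.
  move=> [r _ <-]; right; exists 1%N => //= U oU; rewrite cut_vE => Uu.
  have mU := open_measurable oU.
  rewrite distr_defect2// lte_fin mulr_gt0//.
  apply: lt_le_trans (jump_law_atom r) _.
  by apply: (le_jump_law (measurable_set1 _) (mA _ mU)) => x ->.
case; first by left; left.
move=> [[|[|[|//]]] _ /=] us.
- have [|->|[->|[r ->]]] := @jump_support u.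
  + move=> U oU Uu; have := us U oU Uu.
    by rewrite distr_defect1 ?lte_fin ?pmulr_rgt0//; exact: open_measurable.
  + by do 5!left.
  + by left; left; left; right.
  + by left; right; exists r.
(* The second support is the affine image of the support of the jump law. The extra candidates w = 0
   and w = alpha go to alpha and 2 alpha - beta, both values of h at cuts. *)
- pose w := (u - alpha) / (1 - alpha).
  have uw : u = alpha + (1 - alpha) * w.
    by rewrite /w mulrC divfK ?gt_eqF// addrC subrK.
  have [|w0|[wa|[r wr]]] := @jump_support w.
  + move=> U oU Uw.
    pose V := [set x : R | U ((x - alpha) / (1 - alpha))].
    have oV : open V.
      apply: (@open_comp _ _ (fun x : R => (x - alpha) / (1 - alpha)) U) => // x _.
      by apply: cvgMl; apply: cvgB; [exact: cvg_id|exact: cvg_cst].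
    have := us V oV Uw.
    rewrite distr_defect2 ?lte_fin ?pmulr_rgt0//; last exact: open_measurable.
    rewrite (_ : jump_law _ = jump_law U)//; apply: eq_jump_law => x.
    by rewrite /V /= addrC addKr mulrC mulKf ?gt_eqF.
  + by left; left; left; right; rewrite uw w0; lra.
  + by left; left; right; rewrite uw wa; lra.
  + by right; exists r; rewrite // cut_vE uw wr.
- have := us setT openT I; rewrite distr_defect3 ?ltxx//; exact: measurableT.
Qed.

(** * Topology and cardinality of the cut set *)

Lemma jump_value_mono : {mono jump_value : m n / (m <= n)%N >-> m <= n}.
Proof. by apply/increasing_seqP => n; exact: lt_jump_valueS. Qed.

Lemma lt_jump_value m n : jump_value m < jump_value n -> (m < n)%N.
Proof. by rewrite ltNge jump_value_mono -ltnNge. Qed.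

Lemma cvg_jump_value : jump_value r.+1 @[r --> \oo] --> alpha.
Proof.
have qb := q0_bounds.
have q1 : `|q0| < 1 by rewrite ger0_norm; lra.
rewrite -[X in _ --> X]mulr1; apply: cvgMr.
rewrite -[X in _ --> X]subr0; apply: cvgB; first exact: cvg_cst.
by have := cvg_expr q1; rewrite -cvg_shiftS.
Qed.

Lemma cvg_cut_v : cut_v alpha beta q0 r @[r --> \oo] --> 2 * alpha - beta.
Proof.
rewrite (_ : 2 * alpha - beta = alpha + (1 - alpha) * alpha); last first.
  by rewrite -alpha_alpha; ring.
under eq_fun do rewrite cut_vE.
by apply: cvgD; [exact: cvg_cst|apply: cvgMr; exact: cvg_jump_value].
Qed.

Let cut_points : set R := [set 0; 1; alpha; 2 * alpha - beta]
    `|` range (cut_u alpha q0) `|` range (cut_v alpha beta q0).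

Lemma jump_value_gt0 r : 0 < jump_value r.+1.
Proof. exact: le_lt_trans (jump_value_ge0 r) (lt_jump_valueS r). Qed.

Lemma cut_v_bounds r : alpha < cut_v alpha beta q0 r < 2 * alpha - beta.
Proof.
have ab := alpha_bounds; have a1 : 0 < 1 - alpha by lra.
have aa := alpha_alpha.
have h1 := mulr_gt0 a1 (jump_value_gt0 r).
have : (1 - alpha) * jump_value r.+1 < (1 - alpha) * alpha.
  by rewrite ltr_pM2l// jump_value_lt_alpha.
by rewrite cut_vE; lra.
Qed.

(** Any other point has a neighbourhood with finitely many cuts: below alpha, some u_r and possibly
    0; between the two limits, some v_r; above 2 alpha - beta, only 1. *)
Lemma limit_point_cut_points :
  limit_point cut_points = [set alpha; 2 * alpha - beta].
Proof.
have ab := alpha_bounds; have bb := beta_bounds; have aa := alpha_alpha.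
have a1 : 0 < 1 - alpha by lra.
have lt_nbhs (a t b : R) : a < t < b -> nbhs t `]a, b[%classic.
  by move=> tab; apply: open_nbhs_nbhs; split; [exact: interval_open|rewrite /= in_itv].
apply/seteqP; split=> t; last first.
  move=> [->|->]; apply/limit_pointP.
    exists (cut_u alpha q0); split; last exact: cvg_jump_value.
    - by move=> x; left; right.
    - by move=> n; rewrite cut_uE lt_eqF// jump_value_lt_alpha.
  exists (cut_v alpha beta q0); split; last exact: cvg_cut_v.
  - by move=> x; right.
  - by move=> n; rewrite lt_eqF//; have /andP[] := cut_v_bounds n.
move=> /limit_point_infinite_setP tinf /=; apply: contrapT => /not_orP[ta tb].
have {}ta : t != alpha by apply/eqP.
have {}tb : t != 2 * alpha - beta by apply/eqP.
have [tla|alt|tE] := ltgtP t alpha; last by rewrite tE eqxx in ta.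
  have [n tn] := jump_value_cofinal tla.
  apply: (tinf `]t - 1, jump_value n[%classic); first by apply: lt_nbhs; lra.
  apply: (@sub_finite_set _ _ ([set 0] `|` (cut_u alpha q0) @` `I_n)); last first.
    by rewrite finite_setU; split=> //; apply: finite_image.
  have na := jump_value_lt_alpha n.
  move=> x [/=]; rewrite in_itv /= => xn; rewrite /cut_points /=.
  move=> [[[[[|]|]|]|[r _ xr]]|[r _ xr]]; try (by left); try by lra.
    right; exists r => //=.
    by move: xn; rewrite -xr cut_uE => /andP[_ /lt_jump_value /ltnW].
  by have := cut_v_bounds r; lra.
have [tlb|blt|tE] := ltgtP t (2 * alpha - beta); last by rewrite tE eqxx in tb.
  have [n tn] : exists n, (t - alpha) / (1 - alpha) < jump_value n.
    by apply: jump_value_cofinal; rewrite ltr_pdivrMr// mulrBr; lra.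
  rewrite ltr_pdivrMr// in tn.
  apply: (tinf `]alpha, alpha + jump_value n * (1 - alpha)[%classic).
    by apply: lt_nbhs; lra.
  have nb : jump_value n * (1 - alpha) < alpha * (1 - alpha).
    by rewrite ltr_pM2r// jump_value_lt_alpha.
  apply: (@sub_finite_set _ _ ((cut_v alpha beta q0) @` `I_n)); last first.
    by apply: finite_image.
  move=> x [/=]; rewrite in_itv /= => xn; rewrite /cut_points /=.
  move=> [[[[[|]|]|]|[r _ xr]]|[r _ xr]]; try by lra.
    by have := jump_value_lt_alpha r.+1; rewrite -cut_uE; lra.
  exists r => //=.
  move: xn; rewrite -xr cut_vE mulrC => /andP[_].
  by rewrite ltrD2l ltr_pM2r// => /lt_jump_value /ltnW.
apply: (tinf `]2 * alpha - beta, t + 1[%classic); first by apply: lt_nbhs; lra.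
apply: (@sub_finite_set _ _ [set 1]) => //.
move=> x [/=]; rewrite in_itv /= => xn; rewrite /cut_points /=.
move=> [[[[[|]|]|]|[r _ xr]]|[r _ xr]]; try (by []); try by lra.
  by have := jump_value_lt_alpha r.+1; rewrite -cut_uE; lra.
by have := cut_v_bounds r; lra.
Qed.

Lemma closed_cut_points : closed cut_points.
Proof.
move=> x; rewrite closure_isolated_limit_point limit_point_cut_points.
move=> [/isolatedS//|[->|->]]; first by left; left; left; right.
by left; left; right.
Qed.

Lemma countable_cut_points : countable cut_points.
Proof.
by do 5 (apply: countable_setU; rewrite ?countable1 ?countable_range_nat//).
Qed.

Lemma infinite_cut_points : infinite_set cut_points.
Proof.
have : limit_point cut_points alpha by rewrite limit_point_cut_points; left.
move=> /limit_point_infinite_setP/(_ setT filterT).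
by rewrite setTI.
Qed.

(** * The model on the complement of the cuts *)

(** h may be constant on intervals, but h y < h x still forces y < x. Thus the set of y with psi y
    <= x is squeezed as [jump_law_sandwich] requires; [model_piece2] does the same with phi psi. *)
Lemma model_piece1 x r : 0 <= x ->
  jump_value r < h x < jump_value r.+1 ->
  h (itm alpha beta x) = h x + (q0 + (1 - alpha) * jump_value r).
Proof.
move=> x0 /andP[rx xr]; have ra := jump_value_lt_alpha r.+1.
have x1 : x < 1 - alpha by apply: lt_distr_fun; rewrite distr_fun_cut1; lra.
rewrite itm_piece1// distr_fun_itm1 ?x0// -addrA; congr (_ + (_ + _ * _)).
apply: jump_law_sandwich; first by measurable_tac.
- by move=> y _ hy; apply/ltW/lt_distr_fun; lra.
- by move=> y _ /le_distr_fun; lra.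
Qed.

Lemma model_piece2 x r :
  alpha + (1 - alpha) * jump_value r < h x < alpha + (1 - alpha) * jump_value r.+1 ->
  h (itm alpha beta x) = h x + (2 * q0 - alpha + q0 * jump_value r).
Proof.
move=> /andP[rx xr]; have ra := cut_v_bounds r; rewrite cut_vE in ra.
have ab := alpha_bounds; have a1 : 0 < 1 - alpha by lra.
have qb := q0_bounds.
have r0 := mulr_ge0 (ltW a1) (jump_value_ge0 r).
have x0 : 1 - alpha < x by apply: lt_distr_fun; rewrite distr_fun_cut1; lra.
have x1 : x < 1 - beta by apply: lt_distr_fun; rewrite distr_fun_cut2; lra.
have x01 : 1 - alpha <= x < 1 - beta by rewrite (ltW x0).
rewrite itm_piece2// distr_fun_itm2// -addrA; congr (_ + (_ + _ * _)).
have zE y : 0 <= y < 1 - alpha -> h (1 - alpha + alpha * (q0 + alpha * y)) =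
    alpha + (1 - alpha) * h (q0 + alpha * y).
  move=> y01; rewrite distr_fun_zoom//.
  have : 0 <= alpha * y by apply: mulr_ge0; lra.
  by lra.
apply: jump_law_sandwich; first by measurable_tac.
- move=> y y01 hy; apply/ltW/lt_distr_fun; rewrite zE//.
  by apply: le_lt_trans rx; rewrite lerD2l ler_pM2l.
- move=> y y01 /le_distr_fun; rewrite zE// => hy.
  by have := le_lt_trans hy xr; rewrite ltrD2l ltr_pM2l.
Qed.

Lemma model_piece3 x : x < 1 -> 2 * alpha - beta < h x ->
  h (itm alpha beta x) = h x - (2 * alpha - beta).
Proof.
move=> x1 hx.
have x0 : 1 - beta < x by apply: lt_distr_fun; rewrite distr_fun_cut2.
by rewrite itm_piece3 ?(ltW x0)// distr_fun_itm3// (ltW x0).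
Qed.

(* The interval of index 0 is ]2 alpha - beta, 1[; those of index 2 r + 1 and 2 r + 2
   are ]u_(r-1), u_r[ and ]v_(r-1), v_r[, with u_(-1) = 0 and v_(-1) = alpha.  In this
   order their images are consecutive: the image of index m is
   ]iet_image_cut m, iet_image_cut m.+1[. *)
Definition iet_lo (m : nat) : R :=
  if m is k.+1 then
    if odd k then alpha + (1 - alpha) * jump_value k./2 else jump_value k./2
  else 2 * alpha - beta.

Definition iet_hi (m : nat) : R :=
  if m is k.+1 then
    if odd k then alpha + (1 - alpha) * jump_value k./2.+1 else jump_value k./2.+1
  else 1.

Definition iet_shift (m : nat) : R :=
  if m is k.+1 then
    if odd k then 2 * q0 - alpha + q0 * jump_value k./2
    else q0 + (1 - alpha) * jump_value k./2
  else - (2 * alpha - beta).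

Definition iet_image_cut (m : nat) : R :=
  if m is k.+1 then
    if odd k then q0 + jump_value k./2.+1 + (1 - alpha) * jump_value k./2
    else q0 + (2 - alpha) * jump_value k./2
  else 0.

Lemma iet_lo_shift m : iet_lo m + iet_shift m = iet_image_cut m.
Proof.
case: m => [|k] /=; first by rewrite subrr.
by case: (odd k); rewrite ?jump_valueS; ring.
Qed.

Lemma iet_hi_shift m : iet_hi m + iet_shift m = iet_image_cut m.+1.
Proof.
have qE := q0_lin.
case: m => [|k] /=; first by rewrite jump_value0; lra.
rewrite uphalf_half; case: (odd k) => /=; rewrite ?add1n ?add0n.
  by rewrite jump_valueS; ring.
by ring.
Qed.

Lemma iet_lo_lt_hi m : iet_lo m < iet_hi m.
Proof.
have ab := alpha_bounds; have bb := beta_bounds.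
case: m => [|k] /=; first by lra.
case: (odd k); last exact: lt_jump_valueS.
by rewrite ltrD2l ltr_pM2l ?lt_jump_valueS//; lra.
Qed.

Lemma lt_iet_image_cutS m : iet_image_cut m < iet_image_cut m.+1.
Proof. by rewrite -iet_lo_shift -iet_hi_shift ltrD2r iet_lo_lt_hi. Qed.

Lemma iet_image_cut_ge0 m : 0 <= iet_image_cut m.
Proof. by elim: m => // m /le_trans; apply; exact/ltW/lt_iet_image_cutS. Qed.

Lemma iet_image_cut_lt1 m : iet_image_cut m < 1.
Proof.
have ab := alpha_bounds; have bb := beta_bounds; have aa := alpha_alpha.
have qE := q0_lin.
have bnd r : q0 + (2 - alpha) * jump_value r < 1.
  have : (2 - alpha) * jump_value r < (2 - alpha) * alpha.
    by rewrite ltr_pM2l ?jump_value_lt_alpha//; lra.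
  by lra.
case: m => [|k] /=; first by lra.
have := bnd k./2; have := bnd k./2.+1; case: (odd k) => //.
have : (1 - alpha) * jump_value k./2 <= (1 - alpha) * jump_value k./2.+1.
  by rewrite ler_pM2l ?ltW ?lt_jump_valueS//; lra.
by lra.
Qed.

Lemma iet_image_cut_cofinal t : t < 1 -> exists m, t < iet_image_cut m.
Proof.
have ab := alpha_bounds; have bb := beta_bounds; have aa := alpha_alpha.
have qE := q0_lin => t1.
have [n] : exists n, (t - q0) / (2 - alpha) < jump_value n.
  by apply: jump_value_cofinal; rewrite ltr_pdivrMr; lra.
rewrite ltr_pdivrMr; last by lra.
(* At this index the image cut is q0 + (2 - alpha) [jump_value n], which tends to q0 + 2 alpha -
   beta = 1. *)
move=> tn; exists n.*2.+1 => /=; rewrite odd_double doubleK; lra.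
Qed.

(** The points alpha and 2 alpha - beta separate the three families; inside a family the intervals
    join consecutive terms of an increasing sequence. *)
Lemma iet_lo_hi_inj m n z : iet_lo m < z < iet_hi m -> iet_lo n < z < iet_hi n ->
  m = n.
Proof.
have ab := alpha_bounds; have bb := beta_bounds; have a1 : 0 < 1 - alpha by lra.
have bu r : jump_value r.+1 < alpha := jump_value_lt_alpha _.
have bv r : alpha + (1 - alpha) * jump_value r.+1 < 2 * alpha - beta.
  by rewrite -cut_vE; have /andP[] := cut_v_bounds r.
have bv0 r : alpha <= alpha + (1 - alpha) * jump_value r.
  by rewrite lerDl mulr_ge0 ?jump_value_ge0// ltW.
have iu i j : jump_value i < z < jump_value i.+1 ->
    jump_value j < z < jump_value j.+1 -> i = j.
  by apply: (increasing_bracket_inj (c := jump_value)); exact: lt_jump_valueS.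
pose c i := alpha + (1 - alpha) * jump_value i.
have iv i j : c i < z < c i.+1 -> c j < z < c j.+1 -> i = j.
  by apply: increasing_bracket_inj => k; rewrite ltrD2l ltr_pM2l// lt_jump_valueS.
case: m n => [|k] [|l] //=.
- move=> h0 hl; exfalso; move: hl.
  by have := bv l./2; have := bu l./2; case: (odd l); lra.
- move=> hk h0; exfalso; move: hk.
  by have := bv k./2; have := bu k./2; case: (odd k); lra.
- have : odd k = odd l -> k./2 = l./2 -> k.+1 = l.+1.
    by move=> e1 e2; rewrite -(odd_double_half k) e1 e2 odd_double_half.
  case: (odd k); case: (odd l) => kl hk hl.
  + exact: kl (iv _ _ hk hl).
  + by exfalso; have := bv0 k./2; have := bu l./2; lra.
  + by exfalso; have := bv0 l./2; have := bu k./2; lra.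
  + exact: kl (iu _ _ hk hl).
Qed.

Lemma iet_lo_ge0 m : 0 <= iet_lo m.
Proof.
have ab := alpha_bounds; have bb := beta_bounds; have a1 : 0 <= 1 - alpha by lra.
case: m => [|k] /=; first by lra.
have j0 := jump_value_ge0 k./2; case: (odd k) => //.
by have := mulr_ge0 a1 j0; lra.
Qed.

Lemma iet_hi_le1 m : iet_hi m <= 1.
Proof.
have ab := alpha_bounds; have bb := beta_bounds.
case: m => [|k] //=; case: (odd k).
  by have := cut_v_bounds k./2; rewrite cut_vE; lra.
by have := jump_value_lt_alpha k./2.+1; lra.
Qed.

Lemma iet_cover u : 0 <= u <= 1 -> ~ cut_points u ->
  exists m, iet_lo m < u < iet_hi m.
Proof.
have ab := alpha_bounds; have bb := beta_bounds; have aa := alpha_alpha.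
move=> u01; rewrite /cut_points => nC.
have [ua|au|uE] := ltgtP u alpha; last by exfalso; apply: nC; left; left; left; right.
  have [|r /andP[]] := @jump_value_bracket u; first by lra.
  rewrite le_eqVlt => /orP[/eqP ru _|ru ur].
    exfalso; apply: nC; case: r ru => [|r] ru.
      by do 5!left; rewrite -ru jump_value0.
    by left; right; exists r.
  by exists r.*2.+1 => /=; rewrite odd_double doubleK ru.
have [ub|bu|uE] := ltgtP u (2 * alpha - beta); last by exfalso; apply: nC; left; left; right.
  have [|r] := @jump_value_bracket ((u - alpha) / (1 - alpha)).
    apply/andP; split; first by apply: divr_ge0; lra.
    by rewrite ltr_pdivrMr; lra.
  rewrite ler_pdivlMr ?ltr_pdivrMr; [|lra|lra].
  move=> /andP[]; rewrite le_eqVlt => /orP[/eqP ru _|ru ur].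
    exfalso; apply: nC; case: r ru => [|r] ru.
      by move: ru; rewrite jump_value0 mul0r; lra.
    by right; exists r => //; rewrite cut_vE mulrC ru; lra.
  exists r.*2.+2 => /=; rewrite odd_double /= uphalf_double; lra.
exists 0%N => /=; rewrite bu/= lt_neqAle; apply/andP; split; last by lra.
by apply/eqP => uE; apply: nC; do 4!left; right.
Qed.

(** * Borel images under the distribution function *)

(** Left continuity of h, from [distr_fun_open] and continuity of [mu] from below; [distr_fun_right]
    is the counterpart from above. Together they make [quantile] a right inverse of h on [0, 1]. *)
Lemma distr_fun_left s u : (forall x, x < s -> h x <= u) -> h s <= u.
Proof.
move=> hu; pose F (n : nat) := [set z : R | 0 <= z <= s - n.+1%:R^-1].
have mF n : measurable (F n : set (borel R)) by rewrite /F; measurable_tac.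
have FE : \bigcup_n F n = [set z : R | 0 <= z < s].
  apply/seteqP; split=> z /=.
    move=> [n _]; rewrite /F /= => /andP[-> zs] /=.
    by apply: le_lt_trans zs _; rewrite ltrBlDr ltrDl invr_gt0.
  move=> /andP[z0 zs].
  have sz : 0 < s - z by rewrite subr_gt0.
  have [n nz] := exists_natSinv_lt sz.
  by exists n => //; rewrite /F /= z0 /= lerBrDl -lerBrDr ltW.
have ndF : nondecreasing_seq F.
  move=> m n mn; apply/subsetPset => z; rewrite /F /= => /andP[-> zm] /=.
  by apply: le_trans zm _; rewrite lerB// lef_pV2 ?posrE// ler_nat.
have mFU : measurable (\bigcup_n F n : set (borel R)) by rewrite FE; measurable_tac.
have Fcvg := nondecreasing_cvg_mu (mu := mu) mF mFU ndF.
rewrite distr_fun_open -FE -lee_fin -massE// -(cvg_lim _ Fcvg)//.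
apply: lime_le; first by apply/cvg_ex; exists (mu (\bigcup_n F n)).
apply: nearW => n; rewrite /= massE// lee_fin /F -distr_funE; apply: hu.
by rewrite ltrBlDr ltrDl invr_gt0.
Qed.

Lemma distr_fun_right s u : (forall x, s < x -> u <= h x) -> u <= h s.
Proof.
move=> hu; pose F (n : nat) := [set z : R | 0 <= z <= s + n.+1%:R^-1].
have mF n : measurable (F n : set (borel R)) by rewrite /F; measurable_tac.
have FE : \bigcap_n F n = [set z : R | 0 <= z <= s].
  apply/seteqP; split=> z /=; last first.
    move=> /andP[z0 zs] n _; rewrite /F /= z0 /=.
    by apply: le_trans zs _; rewrite lerDl invr_ge0.
  move=> zF; have /andP[z0 _] := zF 0%N I; rewrite z0 /= leNgt; apply/negP => zs.
  have sz : 0 < z - s by rewrite subr_gt0.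
  have [n nz] := exists_natSinv_lt sz.
  have /andP[_] := zF n I; rewrite -lerBlDl leNgt => /negP; exact.
have ndF : nonincreasing_seq F.
  move=> m n mn; apply/subsetPset => z; rewrite /F /= => /andP[-> zm] /=.
  by apply: le_trans zm _; rewrite lerD2l lef_pV2 ?posrE// ler_nat.
have mFU : measurable (\bigcap_n F n : set (borel R)) by rewrite FE; measurable_tac.
have F0 : (mu (F 0%N) < +oo)%E by rewrite massE// ltry.
have Fcvg := nonincreasing_cvg_mu F0 mF mFU ndF.
rewrite distr_funE -FE -lee_fin -massE// -(cvg_lim _ Fcvg)//.
apply: lime_ge; first by apply/cvg_ex; exists (mu (\bigcap_n F n)).
apply: nearW => n; rewrite /= massE// lee_fin /F -distr_funE; apply: hu.
by rewrite ltrDl invr_gt0.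
Qed.

(* Capping u at 1 makes [quantile] monotone on the whole line: for u > 1 the infimum
   would otherwise be that of the empty set, which is 0. *)
Definition quantile (u : R) : R := inf [set x : R | 0 <= x /\ Num.min u 1 <= h x].

Lemma quantile_has_inf u : has_inf [set x : R | 0 <= x /\ Num.min u 1 <= h x].
Proof.
split; first by exists 1; split=> //=; rewrite distr_fun_ge1// ge_min lexx orbT.
by exists 0 => x [].
Qed.

Lemma quantile_le u x : 0 <= x -> Num.min u 1 <= h x -> quantile u <= x.
Proof. by move=> x0 ux; apply: ge_inf; [have [] := quantile_has_inf u|split]. Qed.

Lemma nondecreasing_quantile : nondecreasing_fun quantile.
Proof.
move=> u v uv; apply: lb_le_inf => [|x [x0 vx]]; first by have [] := quantile_has_inf v.
apply: quantile_le => //; apply: le_trans vx.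
by rewrite le_min ge_min uv /= ge_min lexx orbT.
Qed.

Lemma distr_fun_quantile u : 0 <= u <= 1 -> h (quantile u) = u.
Proof.
move=> /andP[u0 u1].
have mu1 : Num.min u 1 = u by apply/min_idPl.
apply/eqP; rewrite eq_le; apply/andP; split.
  apply: distr_fun_left => x xq; rewrite leNgt; apply/negP => ux.
  have x0 : 0 <= x.
    by rewrite leNgt; apply/negP => x0; move: ux; rewrite distr_fun_le0; lra.
  by have := @quantile_le u x x0; rewrite mu1 => /(_ (ltW ux)); lra.
apply: distr_fun_right => x qx.
have [y [y0 uy] yx] := inf_lt (quantile_has_inf u).1 qx.
by rewrite mu1 in uy; apply: le_trans uy _; apply/le_distr_fun/ltW.
Qed.

(** The value t = 0 is excluded because 0 <= h x also holds for negative x, whereas [quantile 0] =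
    0. *)
Lemma quantile_galois t x : 0 < t <= 1 -> (t <= h x) = (quantile t <= x).
Proof.
move=> /andP[t0 t1]; have mt : Num.min t 1 = t by apply/min_idPl.
apply/idP/idP => [tx|tx]; last first.
  by rewrite -[leLHS]distr_fun_quantile ?t1 ?(ltW t0)//; exact: le_distr_fun.
apply: quantile_le; last by rewrite mt.
by rewrite leNgt; apply/negP => /ltW/distr_fun_le0; lra.
Qed.

(* h @` X and quantile^-1(X) differ by values of h on nontrivial intervals of
   constancy, of which there are countably many. *)
Lemma measurable_distr_image (X : set R) : measurable (X : set (borel R)) ->
  X `<=` `[0, 1[%classic -> measurable (h @` X : set (borel R)).
Proof.
move=> mX X01.
pose D := `[0, 1]%classic : set R.
have mD : measurable (D : set (borel R)) by exact: measurable_itv.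
have mq : measurable_fun (D : set (borel R)) (quantile : borel R -> borel R).
  by apply: nondecreasing_measurable => //; exact: nondecreasing_quantile.
rewrite (_ : h @` X = (D `&` quantile @^-1` X) `|` (h @` X `\` quantile @^-1` X)).
  apply: measurableU; first exact: mq.
  apply: countable_measurable; first by move=> t; exact: measurable_set1.
  apply: (@sub_countable _ _ _ (range (fun q : rat => h (ratr q)))); last first.
    exact: sub_countable (card_image_le _ _) _.
  apply: subset_card_le => u [[x Xx <-] nX].
  have /andP[x0 x1] : 0 <= x < 1 by have := X01 _ Xx; rewrite /= in_itv.
  have hq := @distr_fun_quantile (h x).
  have qx : quantile (h x) <= x by apply: quantile_le => //; rewrite ge_min lexx.
  have {}qx : quantile (h x) < x.
    by rewrite lt_neqAle qx andbT; apply/eqP => qE; apply: nX; rewrite /= qE.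
  have [q] := rat_in_itvoo qx; rewrite in_itv /= => /andP[qq qx'].
  exists q => //; apply/eqP; rewrite eq_le (le_distr_fun (ltW qx')) /=.
  by rewrite -[leLHS]hq ?distr_fun_ge0 ?distr_fun_le1// le_distr_fun// ltW.
apply/seteqP; split=> u.
  move=> hXu; have [qX|nqX] := pselect (X (quantile u)); last by right.
  left; split=> //; case: hXu => x _ <-; rewrite /D /= in_itv /=.
  by rewrite distr_fun_ge0 distr_fun_le1.
case; last by case.
rewrite /D /= in_itv /= => -[u01 Xq]; exists (quantile u) => //.
exact: distr_fun_quantile.
Qed.

(** * The push-forward of the measure by its distribution function *)

HB.instance Definition _ :=
  isMeasurableFun.Build _ _ _ _ (h : borel R -> borel R) measurable_distr_fun.

Definition distr_push : probability (borel R) R :=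
  distribution mu (h : borel R -> borel R).

Lemma measurable_unit_itvcc : measurable (`[0, 1]%classic : set (borel R)).
Proof. exact: measurable_itv. Qed.

(** The probability integral transform. Both measures are compared on the rays [t, +oo), which are
    stable under intersection and generate the Borel sets. *)
Lemma distr_pushE B : measurable B ->
  distr_push B = lebesgue_measure (B `&` `[0, 1]%classic).
Proof.
move=> mB.
have setI_rays : setI_closed (@RGenCInfty.G R).
  move=> _ _ [x ->] [y ->]; exists (Num.max x y).
  by apply/seteqP; split=> z /=; rewrite !in_itv/= !andbT ge_max => /andP.
apply: (@measure_unique _ R (borel R) (@RGenCInfty.G R)
  (fun n => `[- n%:R, +oo[%classic) _ _ _ _ distr_push
  (mrestr (@lebesgue_measure R) measurable_unit_itvcc)) => //.
- exact: RGenCInfty.measurableE.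
- by move=> n; exists (- n%:R).
- apply/seteqP; split=> // x _; exists (Num.bound `|x|) => //=.
  rewrite in_itv /= andbT lerNl; apply: le_trans (ler_norm _) _.
  by rewrite normrN ltW// archi_boundP.
- move=> A [t ->].
  change (mu (h @^-1` `[t, +oo[%classic) =
    lebesgue_measure (`[t, +oo[%classic `&` `[0, 1]%classic)).
  have -> : h @^-1` `[t, +oo[ = [set x | t <= h x].
    by apply/seteqP; split=> x /=; rewrite in_itv/= andbT.
  have [t0|t0] := leP t 0.
    rewrite (_ : [set x | _] = setT); last first.
      by apply/seteqP; split=> // x _ /=; exact: le_trans t0 (distr_fun_ge0 x).
    rewrite probability_setT (_ : _ `&` _ = `[0, 1]%classic).
      by rewrite lebesgue_measure_itv /= lte_fin ltr01 oppr0 adde0.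
    by apply/seteqP; split=> x /=; rewrite !in_itv /=; lra.
  have [t1|t1] := leP t 1.
    rewrite (_ : _ `&` _ = `[t, 1]%classic); last first.
      by apply/seteqP; split=> x /=; rewrite !in_itv /=; lra.
    rewrite lebesgue_measure_itv /= lte_fin.
    have -> : (if t < 1 then (1%:E - t%:E)%E else 0%E) = (1 - t)%:E.
      by case: ltP => // t1'; congr (_%:E); lra.
    (* The complement is a ray below [quantile t], whose mass is h ([quantile t]) = t. *)
    have qE : [set x | t <= h x] = ~` [set x | x < quantile t].
      apply/seteqP; split=> x /=; rewrite quantile_galois ?t0// leNgt; first by move/negP.
      by move=> ?; apply/negP.
    rewrite qE probability_setC; last by measurable_tac.
    rewrite massE; last by measurable_tac.
    rewrite (_ : mass _ = t) ?EFinB//.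
    rewrite -[RHS]distr_fun_quantile ?(ltW t0)// distr_fun_open.
    rewrite -mass_unit_itv; last by measurable_tac.
    rewrite -[RHS]mass_unit_itv; last by measurable_tac.
    by mass_ext.
  rewrite (_ : [set x | _] = set0); last first.
    apply/seteqP; split=> // x /=; apply/negP; rewrite -ltNge.
    exact: le_lt_trans (distr_fun_le1 x) t1.
  rewrite (_ : _ `&` _ = set0) ?measure0//.
  by apply/seteqP; split=> x //=; rewrite !in_itv /=; lra.
- move=> n; apply: le_lt_trans (probability_le1 _ _) (ltry _).
  exact: measurable_itv.
Qed.

(** X lies in the preimage of its image, so the push-forward of [mu] gives full mass to the
    image. *)
Lemma lebesgue_distr_image (X : set R) : measurable (X : set (borel R)) ->
  X `<=` `[0, 1[%classic -> mu X = 1%E ->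
  lebesgue_measure (`[0, 1]%classic `\` h @` X) = 0%E.
Proof.
move=> mX X01 X1; have mY := measurable_distr_image mX X01.
have mC : measurable (~` (h @` X) : set (borel R)) by exact: measurableC.
rewrite setDE setIC -distr_pushE//.
rewrite probability_setC//.
suff -> : distr_push (h @` X) = 1%E by rewrite subee.
apply/eqP; rewrite eq_le probability_le1//= -X1.
apply: le_measure; rewrite ?inE//.
- exact: measurable_distr_pre mY.
- by move=> x Xx; exists x.
Qed.

Lemma countable_null (A : set R) : countable A -> mu A = 0%E.
Proof.
move=> cA; have mA : measurable (A : set (borel R)).
  by apply: countable_measurable cA => t; exact: measurable_set1.
have /countable_injP[f injf] := cA.
pose F (n : nat) : set (borel R) := A `&` [set x | f x = n].
have AF : (A : set (borel R)) `<=` \bigcup_n F n by move=> x Ax; exists (f x).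
apply/(negligibleP mu mA); apply: negligibleS AF _.
apply: negligible_bigcup => n.
have [[x [Ax fx]]|nA] := pselect (exists x, A x /\ f x = n); last first.
  rewrite (_ : F n = set0); first exact: negligible_set0.
  by apply/seteqP; split=> // x [Ax fx]; apply: nA; exists x.
have Fx : F n `<=` [set x] by move=> y [Ay fy]; apply: injf; rewrite ?inE// fy.
apply: negligibleS Fx _; apply/(negligibleP mu (measurable_set1 _)).
by have := massE mu (measurable_set1 x); rewrite mu_diffuse; exact.
Qed.

(** * Trimming the bijective core *)

(** A point outside the support has a null neighbourhood. A small interval around it, cut down to
    [0, 1], avoids the support and hence lies in the component. *)
Lemma component_rational (G : set R) x :
  G = `[0, 1]%classic `\` measure_support mu -> G x ->
  exists q : rat, connected_component G x = connected_component G (ratr q).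
Proof.
move=> GE Gx.
have [/= x01 nsx] : (`[0, 1]%classic `\` measure_support mu) x by rewrite -GE.
rewrite in_itv /= in x01.
have [U [oU [Ux U0]]] : exists U, open U /\ U x /\ ~ (0 < mu U)%E.
  apply: contrapT => nU; apply: nsx => U oU Ux; apply: contrapT => U0.
  by apply: nU; exists U.
have [e /= e0 eU] : nbhs x U by exact: open_nbhs_nbhs.
pose B := [set y : R | 0 <= y <= 1 /\ x - e < y < x + e].
have BG : B `<=` G.
  move=> y [y01 ye]; rewrite GE; split; first by rewrite /= in_itv.
  move=> /(_ U oU) sy; apply: U0; apply: sy; apply: eU => /=.
  by rewrite ltr_norml; lra.
have cB : connected B.
  apply/connected_intervalP => y z [y01 ye] [z01 ze] w yw.
  by split; lra.
have Bx : B x by split; lra.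
(* Clipping to [0, 1] keeps the interval nondegenerate even when x is 0 or 1. *)
have ab : Num.max 0 (x - e) < Num.min 1 (x + e).
  by rewrite gt_max !lt_min; lra.
have [q] := rat_in_itvoo ab; rewrite in_itv /= gt_max lt_min => q01.
exists q; apply: same_connected_component.
have BC : B `<=` connected_component G x by exact: connected_component_max.
by apply: BC; split; lra.
Qed.

Lemma countable_exceptional_points : countable (exceptional_points alpha beta mu).
Proof.
pose G := `[0, 1]%classic `\` measure_support mu.
apply: countable_setU; first by apply: finite_set_countable; exact: finite_seq.
apply: (@sub_countable _ _ _
  (range (fun q : rat => inf (connected_component G (ratr q))) `|`
   range (fun q : rat => sup (connected_component G (ratr q))))); last first.
  by apply: countable_setU; exact: sub_countable (card_image_le _ _) _.
apply: subset_card_le => e [x Gx].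
have [q ->] := component_rational erefl Gx.
by case=> ->; [left|right]; exists q.
Qed.

Section model.
Variables (X0 : set R) (ustar : R).
Hypotheses (X0_core : bijective_core alpha beta mu X0) (ustar01 : 0 <= ustar <= 1).
Let X := trimmed_core alpha beta mu X0.
Let Y := h @` X.

Let Z := \bigcup_(m : int) (bij_iter X0 (itm alpha beta) m @`
  (exceptional_points alpha beta mu `&` X0)).

Let countable_Z : countable Z.
Proof.
apply: bigcup_countable => // m _; apply: sub_countable (card_image_le _ _) _.
apply: sub_countable countable_exceptional_points.
by apply: subset_card_le => x [].
Qed.

Let measurable_Z : measurable (Z : set (borel R)).
Proof. by apply: countable_measurable countable_Z => t; exact: measurable_set1. Qed.

Let X_unit : X `<=` `[0, 1[%classic.
Proof. by move=> x [X0x _]; have [[_ sub _] _] := X0_core; have [] := sub x X0x. Qed.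

Let measurable_X : measurable (X : set (borel R)).
Proof. by have [[mX0 _ _] _] := X0_core; exact: measurableD. Qed.

(** Trimming removes only countably many points, and [mu] charges none of them. *)
Let mu_X : mu X = 1%E.
Proof.
have [[mX0 _ X01] _] := X0_core.
rewrite massE// -X01 massE//; congr (_%:E).
rewrite [RHS](mass_cut mu mX0 measurable_Z) [X in _ = X + _](_ : _ = 0) ?add0r.
  by apply: eq_mass => x /=; split=> -[].
rewrite /real_mass countable_null//.
by apply: sub_countable countable_Z; apply: subset_card_le => x [].
Qed.

Let measurable_Y : measurable (Y : set (borel R)).
Proof. exact: measurable_distr_image. Qed.

(** * The model as a countable interval exchange *)

Local Notation model := (distr_model alpha beta mu X0 ustar).

Lemma model_out u : ~ Y u -> model u = ustar.
Proof. by move=> nY; rewrite /distr_model memNset. Qed.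

Lemma model_in u : Y u -> exists x, [/\ X x, h x = u & model u = h (itm alpha beta x)].
Proof.
move=> Yu; exists (pinv X h u); split.
- have sX : set_surj X Y h by [].
  by apply: (surjpinv_image_sub sX); exists u.
- by apply: pinvK; rewrite inE.
- by rewrite /distr_model mem_set.
Qed.

Lemma model_unit u : 0 <= model u <= 1.
Proof.
have [/model_in[x [_ _ ->]]|/model_out ->//] := pselect (Y u).
by rewrite distr_fun_ge0 distr_fun_le1.
Qed.

Lemma model_translation m u : iet_lo m < u < iet_hi m -> Y u ->
  model u = u + iet_shift m.
Proof.
move=> mu_ /model_in[x [Xx hx ->]]; rewrite -hx in mu_ *.
have /andP[x0 x1] : 0 <= x < 1 by have := X_unit Xx; rewrite /= in_itv.
case: m mu_ => [|k] /=; first by move=> /andP[hx' _]; exact: model_piece3.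
by case: (odd k) => hk; [exact: model_piece2|exact: model_piece1].
Qed.

(** The model is defined through a choice of preimages, so measurability is read off from its
    values: translations on countably many intervals met with Y, a constant off Y, and a countable
    remainder. *)
Lemma measurable_model :
  measurable_fun (`[0, 1]%classic : set (borel R)) (model : borel R -> borel R).
Proof.
move=> mD B mB.
have -> : `[0, 1]%classic `&` model @^-1` B =
  (\bigcup_m [set u : R | Y u /\ (iet_lo m < u < iet_hi m /\ B (u + iet_shift m))])
  `|` [set u : R | ~ Y u /\ (0 <= u <= 1 /\ B ustar)]
  `|` (`[0, 1]%classic `&` model @^-1` B `&` cut_points).
  apply/seteqP; split=> u.
    move=> [u01 Bu]; have := u01; rewrite /= in_itv /= => u01'.
    have [cu|ncu] := pselect (cut_points u); first by right; split.
    left; have [Yu|nYu] := pselect (Y u); last by right; rewrite /= -(model_out nYu).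
    left; have [m mu_] := iet_cover u01' ncu; exists m => //=.
    by rewrite -model_translation.
  case; last by case.
  case=> [[m _ /= [Yu [mu_ Bu]]]|/= [nYu [u01 Bu]]].
    split; last by rewrite /= (model_translation mu_).
    by have := iet_lo_ge0 m; have := iet_hi_le1 m; rewrite /= in_itv /=; lra.
  by split; [rewrite /= in_itv|rewrite /= model_out].
apply: measurableU; first apply: measurableU.
- apply: bigcupT_measurable => m; apply: measurable_and_pred => //.
  by measurable_tac.
- apply: measurable_and_pred; first exact: measurableC.
  have [Bu|nBu] := pselect (B ustar).
    rewrite [X in measurable X](_ : _ = [set u : R | 0 <= u <= 1]); first by measurable_tac.
    by apply/seteqP; split=> u /=; [case|].
  rewrite [X in measurable X](_ : _ = set0); first exact: measurable0.
  by apply/seteqP; split=> u //= [].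
- apply: countable_measurable; first by move=> t; exact: measurable_set1.
  by apply: sub_countable countable_cut_points; apply: subset_card_le => u [].
Qed.

Lemma countable_iet_model : countable_iet model.
Proof.
have leb0 (A : set R) : countable A -> lebesgue_measure A = 0%E.
  exact: countable_lebesgue_measure0.
have VE m : (fun u => u + iet_shift m) @` `]iet_lo m, iet_hi m[%classic =
    `]iet_image_cut m, iet_image_cut m.+1[%classic.
  rewrite translate_preimage -iet_lo_shift -iet_hi_shift.
  by apply/seteqP; split=> z /=; rewrite !in_itv /=; lra.
split.
- by move=> u _; rewrite /= in_itv /= model_unit.
- exact: measurable_model.
exists setT, iet_lo, iet_hi, iet_shift; split; split.
- move=> m _; split; first exact: iet_lo_lt_hi.
  move=> u /=; rewrite !in_itv /= => ?.
  by have := iet_lo_ge0 m; have := iet_hi_le1 m; lra.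
- move=> m n _ _ [z [/=]]; rewrite !in_itv /=; exact: iet_lo_hi_inj.
- apply: leb0; apply: sub_countable countable_cut_points.
  apply: subset_card_le => u [/=]; rewrite in_itv /= => u01 nU.
  apply: contrapT => ncu; have [m mu_] := iet_cover u01 ncu.
  by apply: nU; exists m => //=; rewrite in_itv.
- move=> m _; exists (`[0, 1]%classic `\` Y); split.
  + by apply: measurableD => //; exact: measurable_itv.
  + exact: lebesgue_distr_image.
  move=> u /= /existsNP; rewrite in_itv /= => -[mu_ nE]; split.
    by have := iet_lo_ge0 m; have := iet_hi_le1 m; rewrite in_itv /=; lra.
  by move=> Yu; apply: nE; exact: model_translation.
- move=> m _; rewrite VE => u.
  have := iet_image_cut_lt1 m.+1; have := iet_image_cut_ge0 m.
  by move: (iet_image_cut m.+1) => c; rewrite /= !in_itv /=; lra.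
- move=> m n _ _ [z []]; rewrite !VE.
  have := @increasing_bracket_inj _ iet_image_cut m n z lt_iet_image_cutS.
  move: (iet_image_cut m.+1) (iet_image_cut n.+1) => c d inj.
  by rewrite /= !in_itv /=; exact: inj.
(* The image cuts increase from 0 to 1, so the images miss only these cuts and the point 1. *)
- apply: leb0; apply: (@sub_countable _ _ _ ([set 1] `|` range iet_image_cut)).
    apply: subset_card_le => u [/=]; rewrite in_itv /= => u01 nV.
    have [->|/eqP u1] := pselect (u = 1); first by left.
    have u0 : iet_image_cut 0 <= u by case/andP: u01.
    have {}u1 : u < 1 by rewrite lt_neqAle u1; lra.
    have [m /andP[]] := bracket u0 (iet_image_cut_cofinal u1).
    rewrite le_eqVlt => /orP[/eqP mu_ _|mu_ um]; first by right; exists m.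
    exfalso; apply: nV; exists m => //; rewrite VE.
    by move: (iet_image_cut m.+1) um => c um; rewrite /= in_itv /= mu_.
  by apply: countable_setU => //; exact: countable_range_nat.
Qed.

End model.

End renormalization.

(** A charged singleton would be an atom, its only subsets being itself and the empty set. *)
Lemma nonatomic_set1 (R : realType) (mu : probability (borel R) R) :
  nonatomic mu -> forall x : R, real_mass mu [set x] = 0.
Proof.
move=> na x; have mx : measurable ([set x] : set (borel R)) by exact: measurable_set1.
apply/eqP; rewrite eq_le mass_ge0 andbT leNgt; apply/negP => mx0.
have [|B [mB Bx B0 Blt]] := na _ mx; first by rewrite massE// lte_fin.
have : B = set0 \/ B = [set x] by exact: subset_set1.
by move=> [BE|BE]; [move: B0; rewrite BE measure0 ltxx|move: Blt; rewrite BE ltxx].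
Qed.

Theorem theorem8p7 (R : realType) (alpha beta q0 : R)
    (alpha_gt0 : 0 < alpha) (alpha_lt : alpha < 1 / 2)
    (alpha_root : alpha ^+ 3 - alpha ^+ 2 - 2 * alpha + 1 = 0)
    (betaE : beta = alpha ^+ 2) (q0E : q0 = (1 - alpha) ^+ 2)
    (mu : probability (borel R) R)
    (mu_unique : uniquely_invariant alpha beta mu)
    (mu_nonatomic : nonatomic mu) :
  let C := defect_cut_set alpha beta mu in
  [/\ C = [set 0; 1; alpha; 2 * alpha - beta]
          `|` range (cut_u alpha q0) `|` range (cut_v alpha beta q0),
      [/\ closed C, countable C, infinite_set C &
          lebesgue_measure C = 0%E],
      limit_point C = [set alpha; 2 * alpha - beta] &
      forall (X0 : set R) (ustar : R),
        bijective_core alpha beta mu X0 -> 0 <= ustar <= 1 ->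
        countable_iet (distr_model alpha beta mu X0 ustar)].
Proof.
move=> C.
have [mu_inv mu_uniq] := mu_unique.
have mu_diffuse := nonatomic_set1 mu_nonatomic.
have CE : C = [set 0; 1; alpha; 2 * alpha - beta]
    `|` range (cut_u alpha q0) `|` range (cut_v alpha beta q0).
  exact: defect_cut_setE.
have countC : countable C by rewrite CE; exact: countable_cut_points.
split.
- exact: CE.
- split=> //; last exact: countable_lebesgue_measure0.
  + by rewrite CE; exact: closed_cut_points.
  + by rewrite CE; exact: infinite_cut_points.
- by rewrite CE; exact: limit_point_cut_points.
- by move=> X0 ustar X0_core ustar01; exact: countable_iet_model.
Qed.
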